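(* Let $R$ be a commutative noetherian ring and let $A$ be a separable flat $R$-algebra that is a noetherian ring (neither assumed commutative, nor assumed finitely generated over $R$). Then there is an equivalence of triangulated categories $$E_S\colon \mathrm{S}(A)\xrightarrow{\ \simeq\ }\mathrm{Mod}_{\mathrm{S}(R)}A$$ between the singularity category $\mathrm{S}(A)$ of $A$ and the category $\mathrm{Mod}_{\mathrm{S}(R)}A$ of modules in $\mathrm{S}(R)$ over the monad $A\otimes_R-\colon \mathrm{S}(R)\to \mathrm{S}(R)$.
   Context: Singularity category: for a noetherian (not necessarily commutative) ring $B$, $\mathrm{S}(B)=\mathrm{K}_{\mathrm{ac}}(\mathrm{Inj}\,B)$ is the full triangulated subcategory of the homotopy category $\mathrm{K}(B)=\mathrm{K}(\mathrm{Mod}\,B)$ consisting of the acyclic complexes of injective $B$-modules. Separable algebra: an $R$-algebra $A$ is separable if the multiplication $A\otimes_R A\to A$ admits a section which is a morphism of $A$-$A$-bimodules. Flat means flat as an $R$-module. The monad: since $A$ is flat over the noetherian ring $R$, degreewise tensoring $A\otimes_R-$ (followed by restriction to $R$) sends acyclic complexes of injective $R$-modules to acyclic complexes of injective $R$-modules, so it defines a triangulated functor $A\otimes_R-\colon \mathrm{S}(R)\to\mathrm{S}(R)$. It is a monad with multiplication $\mu\otimes_R-$ and unit $\eta\otimes_R-$, where $\mu\colon A\otimes_RA\to A$ and $\eta\colon R\to A$ are the multiplication and unit of $A$. It is a separable monad: a triangulated monad $(M,\mu,\eta)$ is separable if there is a natural transformation $\sigma\colon M\to M^2$, commuting with suspension,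 with $\mu\circ\sigma=\mathrm{Id}_M$ and $M\mu\circ\sigma_M=\sigma\circ\mu=\mu_M\circ M\sigma$. Modules over a monad: for a monad $(M,\mu,\eta)$ on a category $\mathscr C$, $\mathrm{Mod}_{\mathscr C}M$ is the Eilenberg–Moore category: objects are pairs $(X,\alpha)$ with $\alpha\colon M(X)\to X$ satisfying $\alpha\circ M\alpha=\alpha\circ\mu_X$ and $\alpha\circ\eta_X=\mathrm{id}_X$; morphisms are morphisms in $\mathscr C$ commuting with the actions. $\mathrm{Mod}_{\mathrm{S}(R)}A$ denotes this category for $\mathscr C=\mathrm{S}(R)$ and $M=A\otimes_R-$. Triangulated structure on modules: when $\mathscr C$ is an idempotent complete triangulated category (such as $\mathrm{S}(R)$) and $M$ is a separable triangulated monad, $\mathrm{Mod}_{\mathscr C}M$ is triangulated (a theorem of Balmer), the suspension being inherited from $\mathscr C$ and the distinguished triangles being exactly those triangles of modules whose underlying diagram is a distinguished triangle in $\mathscr C$. *)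

(* Defs.v *)
From HB Require Import structures.
From mathcomp Require Import all_boot all_order all_algebra.
From mathcomp Require Import boolp.

Set Implicit Arguments.
Unset Strict Implicit.
Unset Printing Implicit Defensive.

Import GRing.Theory.
Local Open Scope ring_scope.
Local Open Scope quotient_scope.

(* Rings may be zero: this is why the "pz" structures are used throughout.
   Modules are left modules. *)

Definition Lin (R : pzRingType) (U V : lmodType R) (f : U -> V)
    (hf : linear f) : {linear U -> V} :=
  HB.pack f (GRing.isLinear.Build R U V *:%R f hf).

Definition left_ideal (B : pzRingType) (I : B -> Prop) : Prop :=
  [/\ I 0, forall x y, I x -> I y -> I (x + y)
    & forall a x, I x -> I (a * x)].

Definition left_noetherian (B : pzRingType) : Prop :=
  forall I : nat -> B -> Prop,
    (forall k, left_ideal (I k)) ->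
    (forall k x, I k x -> I k.+1 x) ->
    exists k, forall m x, (k <= m)%N -> I m x -> I k x.

(* A ring is noetherian when it is so on both sides; B^c is the opposite ring. *)
Definition noetherian_ring (B : pzRingType) : Prop :=
  left_noetherian B /\ left_noetherian B^c.

Definition injective_module (B : pzRingType) (E : lmodType B) : Prop :=
  forall (U V : lmodType B) (i : {linear U -> V}) (f : {linear U -> E}),
    injective i -> exists g : {linear V -> E}, forall u, g (i u) = f u.

Section Tensor.
Variables (R : comPzRingType) (M N : lmodType R).

Definition bilin (V : lmodType R) (b : M -> N -> V) : Prop :=
  (forall x, linear (b x)) /\ (forall y, linear (b^~ y)).

Definition fsum (V : lmodType R) (b : M -> N -> V) (s : seq (M * N)) : V :=
  \sum_(p <- s) b p.1 p.2.

(* A list [:: (x1, y1); ..; (xk, yk)] stands for x1 (x) y1 + .. + xk (x) yk;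
   two lists are identified when no bilinear map separates them.  That this
   quotient has the universal property of the tensor product is [tliftE]
   together with [tens_ext]. *)
Definition tens_equiv (s t : seq (M * N)) : bool :=
  `[< forall (V : lmodType R) (b : M -> N -> V), bilin b -> fsum b s = fsum b t >].

Lemma tens_equiv_refl : reflexive tens_equiv.
Proof. by move=> s; apply/asboolP. Qed.

Lemma tens_equiv_sym : symmetric tens_equiv.
Proof.
by move=> s t; apply/asboolP/asboolP => h V b hb; rewrite (h V b hb).
Qed.

Lemma tens_equiv_trans : transitive tens_equiv.
Proof.
move=> t s u /asboolP h1 /asboolP h2; apply/asboolP => V b hb.
by rewrite (h1 V b hb) (h2 V b hb).
Qed.

Canonical tens_equiv_rel :=
  EquivRel tens_equiv tens_equiv_refl tens_equiv_sym tens_equiv_trans.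

Definition tens : Type := {eq_quot tens_equiv}.
HB.instance Definition _ := Choice.on tens.
HB.instance Definition _ := Quotient.on tens.
HB.instance Definition _ := EqQuotient.on tens.

Definition tapp (V : lmodType R) (b : M -> N -> V) (u : tens) : V :=
  fsum b (repr u).

Lemma tapp_pi (V : lmodType R) (b : M -> N -> V) s :
  bilin b -> tapp b (\pi_tens s) = fsum b s.
Proof.
move=> hb; rewrite /tapp.
have /eqmodP/asboolP h : repr (\pi_tens s) = s %[mod tens] by rewrite reprK.
exact: (h V b hb).
Qed.

Lemma tapp_sep (u v : tens) :
  (forall (V : lmodType R) (b : M -> N -> V), bilin b -> tapp b u = tapp b v) ->
  u = v.
Proof.
move=> h; rewrite -[u]reprK -[v]reprK; apply/eqmodP/asboolP => V b hb.
exact: h.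
Qed.

Definition tens_zero : tens := \pi_tens [::].
Definition tens_opp (u : tens) : tens :=
  \pi_tens [seq (- p.1, p.2) | p <- repr u].
Definition tens_add (u v : tens) : tens := \pi_tens (repr u ++ repr v).
Definition tens_scale (r : R) (u : tens) : tens :=
  \pi_tens [seq (r *: p.1, p.2) | p <- repr u].

Section Tapp.
Variables (V : lmodType R) (b : M -> N -> V).
Hypothesis hb : bilin b.

Lemma bilinZl r x y : b (r *: x) y = r *: b x y.
Proof. exact: (linearZ_LR (Lin (hb.2 y))). Qed.

Lemma tapp0 : tapp b tens_zero = 0.
Proof. by rewrite tapp_pi // /fsum big_nil. Qed.

Lemma tappD u v : tapp b (tens_add u v) = tapp b u + tapp b v.
Proof. by rewrite tapp_pi // /fsum big_cat. Qed.

Lemma tappZ r u : tapp b (tens_scale r u) = r *: tapp b u.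
Proof.
rewrite tapp_pi // /fsum big_map scaler_sumr.
by apply: eq_bigr => p _; rewrite bilinZl.
Qed.

Lemma tappN u : tapp b (tens_opp u) = - tapp b u.
Proof.
rewrite tapp_pi // /fsum big_map -sumrN.
by apply: eq_bigr => p _; rewrite /= -scaleN1r bilinZl scaleN1r.
Qed.
End Tapp.

Fact tens_addA : associative tens_add.
Proof. by move=> u v w; apply: tapp_sep => V b hb; rewrite !tappD // addrA. Qed.
Fact tens_addC : commutative tens_add.
Proof. by move=> u v; apply: tapp_sep => V b hb; rewrite !tappD // addrC. Qed.
Fact tens_add0 : left_id tens_zero tens_add.
Proof. by move=> u; apply: tapp_sep => V b hb; rewrite tappD // tapp0 // add0r. Qed.
Fact tens_addN : left_inverse tens_zero tens_opp tens_add.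
Proof.
by move=> u; apply: tapp_sep => V b hb; rewrite tappD // tappN // tapp0 // addNr.
Qed.
HB.instance Definition _ :=
  GRing.isZmodule.Build tens tens_addA tens_addC tens_add0 tens_addN.

Fact tens_scaleA r s u : tens_scale r (tens_scale s u) = tens_scale (r * s) u.
Proof. by apply: tapp_sep => V b hb; rewrite !tappZ // scalerA. Qed.
Fact tens_scale1 : left_id 1 tens_scale.
Proof. by move=> u; apply: tapp_sep => V b hb; rewrite tappZ // scale1r. Qed.
Fact tens_scaleDr : right_distributive tens_scale +%R.
Proof.
move=> r u v; apply: tapp_sep => V b hb.
by rewrite tappZ // !(tappD hb) !tappZ // scalerDr.
Qed.
Fact tens_scaleDl u : {morph tens_scale^~ u : r s / r + s}.
Proof.
move=> r s; apply: tapp_sep => V b hb.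
by rewrite tappZ // (tappD hb) !tappZ // scalerDl.
Qed.
HB.instance Definition _ :=
  GRing.Zmodule_isLmodule.Build R tens
    tens_scaleA tens_scale1 tens_scaleDr tens_scaleDl.

Definition tpure (x : M) (y : N) : tens := \pi_tens [:: (x, y)].

Lemma tapp_pure (V : lmodType R) (b : M -> N -> V) x y :
  bilin b -> tapp b (tpure x y) = b x y.
Proof. by move=> hb; rewrite tapp_pi // /fsum big_seq1. Qed.

Lemma tapp_linear (V : lmodType R) (b : M -> N -> V) :
  bilin b -> linear (tapp b).
Proof. by move=> hb r u v; rewrite (tappD hb) (tappZ hb). Qed.

Lemma tpure_bilin : bilin tpure.
Proof.
split=> [x r y y'|y r x x']; apply: tapp_sep => V b hb;
  rewrite (tapp_linear hb) !tapp_pure //.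
- exact: hb.1.
- exact: hb.2.
Qed.

Definition tlift (V : lmodType R) (b : M -> N -> V) (hb : bilin b) :
  {linear tens -> V} := locked (Lin (tapp_linear hb)).

Lemma tliftE (V : lmodType R) (b : M -> N -> V) (hb : bilin b) x y :
  tlift hb (tpure x y) = b x y.
Proof. by rewrite /tlift -lock; apply: tapp_pure. Qed.

Lemma tens_decomp (u : tens) : u = \sum_(p <- repr u) tpure p.1 p.2.
Proof.
apply: tapp_sep => V b hb.
rewrite -[RHS]/(Lin (tapp_linear hb) _) linear_sum.
by apply: eq_bigr => p _; rewrite [RHS]tapp_pure.
Qed.

Lemma tens_ext (V : lmodType R) (f g : {linear tens -> V}) :
  (forall x y, f (tpure x y) = g (tpure x y)) -> f =1 g.
Proof.
move=> h u; rewrite (tens_decomp u) !linear_sum.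
by apply: eq_bigr => p _; apply: h.
Qed.
End Tensor.

Section TensorMap.
Variables (R : comPzRingType).

Lemma tmap_bilin (M M' N N' : lmodType R)
    (f : {linear M -> M'}) (g : {linear N -> N'}) :
  bilin (fun x y => tpure (f x) (g y)).
Proof.
have [h1 h2] := tpure_bilin M' N'.
by split=> [x r y y'|y r x x']; rewrite /= linearP; [apply: h1 | apply: h2].
Qed.

Definition tmap (M M' N N' : lmodType R)
    (f : {linear M -> M'}) (g : {linear N -> N'}) :
  {linear tens M N -> tens M' N'} := tlift (tmap_bilin f g).

Arguments tmap : simpl never.

Lemma tmapE (M M' N N' : lmodType R)
    (f : {linear M -> M'}) (g : {linear N -> N'}) x y :
  tmap f g (tpure x y) = tpure (f x) (g y).
Proof. exact: tliftE. Qed.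

Definition flat_module (M : lmodType R) : Prop :=
  forall (X Y : lmodType R) (f : {linear X -> Y}),
    injective f -> injective (tmap (idfun : {linear M -> M}) f).

End TensorMap.

Record algebra (R : comPzRingType) := Algebra {
  alg_ring :> pzRingType;
  alg_unit : {rmorphism R -> alg_ring};
  alg_central : forall r a, alg_unit r * a = a * alg_unit r
}.

Definition alg_mod (R : comPzRingType) (A : algebra R) : Type := A.

Section AlgMod.
Variables (R : comPzRingType) (A : algebra R).

HB.instance Definition _ := GRing.PzRing.on (alg_mod A).

Definition alg_scale (r : R) (a : alg_mod A) : alg_mod A := alg_unit A r * a.

Fact alg_scaleA r s a : alg_scale r (alg_scale s a) = alg_scale (r * s) a.
Proof. by rewrite /alg_scale mulrA rmorphM. Qed.
Fact alg_scale1 : left_id 1 alg_scale.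
Proof. by move=> a; rewrite /alg_scale rmorph1 mul1r. Qed.
Fact alg_scaleDr : right_distributive alg_scale +%R.
Proof. by move=> r a b; apply: mulrDr. Qed.
Fact alg_scaleDl a : {morph alg_scale^~ a : r s / r + s}.
Proof. by move=> r s; rewrite /alg_scale rmorphD mulrDl. Qed.
HB.instance Definition _ :=
  GRing.Zmodule_isLmodule.Build R (alg_mod A)
    alg_scaleA alg_scale1 alg_scaleDr alg_scaleDl.

Lemma alg_scaleE r (a : alg_mod A) : r *: a = alg_unit A r * a.
Proof. by []. Qed.

Fact lmul_linear (a : alg_mod A) : linear (fun x : alg_mod A => a * x).
Proof.
by move=> r x y; rewrite mulrDr !alg_scaleE [in LHS]mulrA -alg_central -mulrA.
Qed.
Fact rmul_linear (a : alg_mod A) : linear (fun x : alg_mod A => x * a).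
Proof. by move=> r x y; rewrite mulrDl !alg_scaleE -mulrA. Qed.

Definition lmul (a : alg_mod A) : {linear alg_mod A -> alg_mod A} :=
  Lin (lmul_linear a).
Definition rmul (a : alg_mod A) : {linear alg_mod A -> alg_mod A} :=
  Lin (rmul_linear a).

Fact mul_bilin : bilin (fun a b : alg_mod A => a * b).
Proof. by split=> [a|b]; [apply: lmul_linear | apply: rmul_linear]. Qed.

Definition alg_mul : {linear tens (alg_mod A) (alg_mod A) -> alg_mod A} :=
  tlift mul_bilin.

Definition separable_algebra : Prop :=
  exists s : {additive alg_mod A -> tens (alg_mod A) (alg_mod A)},
    [/\ forall a x, s (a * x) = tmap (lmul a) idfun (s x),
        forall x a, s (x * a) = tmap idfun (rmul a) (s x)
      & forall x, alg_mul (s x) = x].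

Section Action.
Variable X : lmodType R.

Fact tact_bilin :
  bilin (fun (a : alg_mod A) (t : tens (alg_mod A) X) => tmap (lmul a) idfun t).
Proof.
split=> [a|t r a b]; first exact: linearP.
have h : linear (fun t : tens (alg_mod A) X =>
    r *: tmap (lmul a) idfun t + tmap (lmul b) idfun t).
  move=> k u v; rewrite (linearP (tmap (lmul a) idfun)).
  rewrite (linearP (tmap (lmul b) idfun)) !scalerDr !scalerA.
  by rewrite (mulrC r k) addrACA.
apply: (tens_ext (g := Lin h)) => x y; rewrite /= !tmapE /=.
rewrite mulrDl alg_scaleE -mulrA -alg_scaleE.
exact: (tpure_bilin _ _).2.
Qed.

Definition tact : {linear tens (alg_mod A) (tens (alg_mod A) X) -> tens (alg_mod A) X} :=
  tlift tact_bilin.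

Arguments tact : simpl never.

Lemma tactE a t : tact (tpure a t) = tmap (lmul a) idfun t.
Proof. exact: tliftE. Qed.

Fact ins_linear : linear (tpure (1 : alg_mod A) : X -> tens (alg_mod A) X).
Proof. exact: (tpure_bilin _ _).1. Qed.

Definition ins : {linear X -> tens (alg_mod A) X} := Lin ins_linear.
Arguments ins : simpl never.
End Action.

(* A (x)_R f, seen as a map of R-modules. *)
Definition tA (X Y : lmodType R) (f : {linear X -> Y}) :
  {linear tens (alg_mod A) X -> tens (alg_mod A) Y} := tmap idfun f.

Arguments tA : simpl never.

Lemma tAE (X Y : lmodType R) (f : {linear X -> Y}) a x : tA f (tpure a x) = tpure a (f x).
Proof. exact: tmapE. Qed.

Lemma tA_ext (X Y : lmodType R) (f g : {linear X -> Y}) : f =1 g -> tA f =1 tA g.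
Proof. by move=> h; apply: tens_ext => a x; rewrite !tAE h. Qed.

Lemma tA_id (X : lmodType R) (t : tens (alg_mod A) X) : tA (idfun : {linear X -> X}) t = t.
Proof.
by apply: (tens_ext (g := (idfun : {linear _ -> _}))) => a x; rewrite tAE.
Qed.

Lemma tA_comp (X Y Z : lmodType R) (g : {linear Y -> Z}) (f : {linear X -> Y}) t :
  tA g (tA f t) = tA (g \o f) t.
Proof.
by apply: (tens_ext (f := (tA g \o tA f))) => a x; rewrite /= !tAE.
Qed.

Lemma tpureD (X : lmodType R) (a : alg_mod A) (x y : X) :
  tpure a (x + y) = tpure a x + tpure a y.
Proof. by have := (tpure_bilin (alg_mod A) X).1 a 1 x y; rewrite !scale1r. Qed.

Lemma tpure0 (X : lmodType R) (a : alg_mod A) : tpure a (0 : X) = 0.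
Proof. exact: (linear0 (Lin ((tpure_bilin (alg_mod A) X).1 a))). Qed.

Lemma tpureN (X : lmodType R) (a : alg_mod A) (x : X) :
  tpure a (- x) = - tpure a x.
Proof. exact: (linearN (Lin ((tpure_bilin (alg_mod A) X).1 a))). Qed.

Lemma tAD (X Y : lmodType R) (f g : {linear X -> Y}) t : tA (f \+ g) t = tA f t + tA g t.
Proof.
apply: (tens_ext (f := tA (f \+ g)) (g := tA f \+ tA g)) => a x.
by rewrite /= !tAE /= tpureD.
Qed.

Lemma tAN (X Y : lmodType R) (f : {linear X -> Y}) t : tA (\- f) t = - tA f t.
Proof.
apply: (tens_ext (f := tA (\- f)) (g := \- tA f)) => a x.
by rewrite /= !tAE /= tpureN.
Qed.

Lemma tA0 (X Y : lmodType R) (f : {linear X -> Y}) t : (forall x, f x = 0) -> tA f t = 0.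
Proof.
move=> h; apply: (tens_ext (f := tA f) (g := \0)) => a x.
by rewrite tAE h tpure0.
Qed.

Lemma tact_nat (X Y : lmodType R) (f : {linear X -> Y}) t :
  tact Y (tA (tA f) t) = tA f (tact X t).
Proof.
apply: (tens_ext (f := tact Y \o tA (tA f)) (g := tA f \o tact X)) => a u /=.
rewrite tAE !tactE.
apply: (tens_ext (f := tmap (lmul a) idfun \o tA f)
                 (g := tA f \o tmap (lmul a) idfun)) => b x /=.
by rewrite !tAE !tmapE.
Qed.

Lemma tact_assoc (X : lmodType R) (t : tens (alg_mod A) (tens (alg_mod A) (tens (alg_mod A) X))) :
  tact X (tA (tact X) t) = tact X (tact _ t).
Proof.
apply: (tens_ext (f := tact X \o tA (tact X)) (g := tact X \o tact _)) => a u /=.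
rewrite tAE !tactE.
apply: (tens_ext (f := tmap (lmul a) idfun \o tact X)
                 (g := tact X \o tmap (lmul a) idfun)) => b v /=.
rewrite tmapE !tactE /=.
apply: (tens_ext (f := tmap (lmul a) idfun \o tmap (lmul b) idfun)
                 (g := tmap (lmul (a * b)) idfun)) => c x /=.
by rewrite !tmapE /= mulrA.
Qed.

Lemma tact_ins (X : lmodType R) (t : tens (alg_mod A) X) : tact X (ins _ t) = t.
Proof.
rewrite tactE; apply: (tens_ext (g := (idfun : {linear _ -> _}))) => a x.
by rewrite tmapE /= mul1r.
Qed.

Lemma tact_tA_ins (X : lmodType R) (t : tens (alg_mod A) X) : tact X (tA (ins X) t) = t.
Proof.
apply: (tens_ext (f := tact X \o tA (ins X)) (g := (idfun : {linear _ -> _}))).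
by move=> a x /=; rewrite tAE tactE tmapE /= mulr1.
Qed.

Lemma ins_nat (X Y : lmodType R) (f : {linear X -> Y}) x : tA f (ins X x) = ins Y (f x).
Proof. exact: tAE. Qed.

End AlgMod.

Reserved Notation "g ∘ f" (at level 40, left associativity).

Record category := Category {
  ob :> Type;
  mor : ob -> ob -> zmodType;
  idm : forall X, mor X X;
  cmp : forall X Y Z, mor Y Z -> mor X Y -> mor X Z;
  cmp1m : forall X Y (f : mor X Y), cmp (idm Y) f = f;
  cmpm1 : forall X Y (f : mor X Y), cmp f (idm X) = f;
  cmpA : forall X Y Z W (h : mor Z W) (g : mor Y Z) (f : mor X Y),
    cmp h (cmp g f) = cmp (cmp h g) f;
  cmpDl : forall X Y Z (g g' : mor Y Z) (f : mor X Y),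
    cmp (g + g') f = cmp g f + cmp g' f;
  cmpDr : forall X Y Z (g : mor Y Z) (f f' : mor X Y),
    cmp g (f + f') = cmp g f + cmp g f'
}.
Arguments idm {c} X.

Notation "g ∘ f" := (cmp g f) : ring_scope.

Definition is_iso (C : category) (X Y : C) (f : mor X Y) : Prop :=
  exists g : mor Y X, g ∘ f = idm X /\ f ∘ g = idm Y.

Record functor (C D : category) := Functor {
  fob :> C -> D;
  fmap : forall X Y, mor X Y -> mor (fob X) (fob Y);
  fmapD : forall X Y (f g : mor X Y), fmap (f + g) = fmap f + fmap g;
  fmap1 : forall X, fmap (idm X) = idm (fob X);
  fmapM : forall X Y Z (g : mor Y Z) (f : mor X Y),
    fmap (g ∘ f) = fmap g ∘ fmap f
}.
Arguments fmap {C D} F {X Y} : rename.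

Lemma cmp0m (D : category) (U V W : D) (f : mor U V) :
  (0 : mor V W) ∘ f = 0.
Proof. by apply: (addIr (0 ∘ f)); rewrite -cmpDl !add0r. Qed.
Lemma cmpm0 (D : category) (U V W : D) (f : mor V W) :
  f ∘ (0 : mor U V) = 0.
Proof. by apply: (addIr (f ∘ 0)); rewrite -cmpDr !add0r. Qed.
Lemma cmpNm (D : category) (U V W : D) (g : mor V W) (f : mor U V) :
  (- g) ∘ f = - (g ∘ f).
Proof. by apply: (addIr (g ∘ f)); rewrite -cmpDl !addNr cmp0m. Qed.
Lemma cmpmN (D : category) (U V W : D) (g : mor V W) (f : mor U V) :
  g ∘ (- f) = - (g ∘ f).
Proof. by apply: (addIr (g ∘ f)); rewrite -cmpDr !addNr cmpm0. Qed.
Lemma fmap0 (D E : category) (F : functor D E) (U V : D) :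
  fmap F (0 : mor U V) = 0.
Proof. by apply: (addIr (fmap F 0)); rewrite -fmapD !add0r. Qed.
Lemma fmapN (D E : category) (F : functor D E) (U V : D) (f : mor U V) :
  fmap F (- f) = - fmap F f.
Proof. by apply: (addIr (fmap F f)); rewrite -fmapD !addNr fmap0. Qed.

Lemma is_iso_fmap (C D : category) (F : functor C D) (X Y : C) (f : mor X Y) :
  is_iso f -> is_iso (fmap F f).
Proof. by case=> g [gf fg]; exists (fmap F g); rewrite -!fmapM gf fg !fmap1. Qed.

Lemma is_iso_comp (C : category) (X Y Z : C) (g : mor Y Z) (f : mor X Y) :
  is_iso g -> is_iso f -> is_iso (g ∘ f).
Proof.
case=> g' [g'g gg'] [f' [f'f ff']]; exists (f' ∘ g'); split.
  by rewrite cmpA -(cmpA f') g'g cmpm1.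
by rewrite cmpA -(cmpA g) ff' cmpm1.
Qed.

Definition id_functor (C : category) : functor C C :=
  @Functor C C id (fun X Y f => f)
    (fun X Y f g => erefl) (fun X => erefl) (fun X Y Z g f => erefl).

Section CompFunctor.
Variables (C D E : category) (G : functor D E) (F : functor C D).

Fact comp_fmapD X Y (f g : mor X Y) :
  fmap G (fmap F (f + g)) = fmap G (fmap F f) + fmap G (fmap F g).
Proof. by rewrite !fmapD. Qed.
Fact comp_fmap1 X : fmap G (fmap F (idm X)) = idm (G (F X)).
Proof. by rewrite !fmap1. Qed.
Fact comp_fmapM X Y Z (g : mor Y Z) (f : mor X Y) :
  fmap G (fmap F (g ∘ f)) = fmap G (fmap F g) ∘ fmap G (fmap F f).
Proof. by rewrite !fmapM. Qed.

Definition comp_functor : functor C E :=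
  @Functor C E (fun X => G (F X)) (fun X Y f => fmap G (fmap F f))
    comp_fmapD comp_fmap1 comp_fmapM.
End CompFunctor.

Definition natural (C D : category) (F G : functor C D)
    (t : forall X, mor (F X) (G X)) : Prop :=
  forall X Y (f : mor X Y), t Y ∘ fmap F f = fmap G f ∘ t X.

Definition nat_isomorphic (C D : category) (F G : functor C D) : Prop :=
  exists t : forall X, mor (F X) (G X), natural t /\ forall X, is_iso (t X).

Definition is_equivalence (C D : category) (F : functor C D) : Prop :=
  exists G : functor D C,
    nat_isomorphic (comp_functor G F) (id_functor C) /\
    nat_isomorphic (comp_functor F G) (id_functor D).

(* The data of a triangulated category: the notions of exact functor and of
   triangulated monad below depend only on the suspension and on the class of
   distinguished triangles X -> Y -> Z -> susp X, not on the axioms TR1-TR4. *)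
Record tcategory := TCategory {
  tcat :> category;
  susp : functor tcat tcat;
  dist : forall X Y Z : tcat,
    mor X Y -> mor Y Z -> mor Z (susp X) -> Prop
}.
Arguments susp {t}.
Arguments dist {t X Y Z}.

Record exact_functor (C D : tcategory) := ExactFunctor {
  efun :> functor C D;
  esusp : forall X, mor (efun (susp X)) (susp (efun X));
  esusp_nat :
    natural (F := comp_functor efun susp) (G := comp_functor susp efun) esusp;
  esusp_iso : forall X, is_iso (esusp X);
  efun_dist : forall X Y Z (f : mor X Y) (g : mor Y Z) (h : mor Z (susp X)),
    dist f g h ->
    dist (fmap efun f) (fmap efun g) (esusp X ∘ fmap efun h)
}.
Arguments esusp {C D} F X : rename.

Record tmonad (C : tcategory) := TMonad {
  tm :> exact_functor C C;
  tmul : forall X, mor (tm (tm X)) (tm X);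
  tunit : forall X, mor X (tm X);
  tmul_nat : natural (F := comp_functor tm tm) (G := tm) tmul;
  tunit_nat : natural (F := id_functor C) (G := tm) tunit;
  tmulA : forall X, tmul X ∘ fmap tm (tmul X) = tmul X ∘ tmul (tm X);
  tmul1l : forall X, tmul X ∘ tunit (tm X) = idm (tm X);
  tmul1r : forall X, tmul X ∘ fmap tm (tunit X) = idm (tm X);
  (* multiplication and unit commute with the suspension *)
  tmul_susp : forall X,
    esusp tm X ∘ tmul (susp X) =
      fmap susp (tmul X) ∘ esusp tm (tm X) ∘ fmap tm (esusp tm X);
  tunit_susp : forall X, esusp tm X ∘ tunit (susp X) = fmap susp (tunit X)
}.
Arguments tmul {C} M X : rename.
Arguments tunit {C} M X : rename.

Section EilenbergMoore.
Variables (C : tcategory) (M : tmonad C).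

Record tmodule := TModule {
  mcar :> C;
  mact : mor (M mcar) mcar;
  mactA : mact ∘ fmap M mact = mact ∘ tmul M mcar;
  mact1 : mact ∘ tunit M mcar = idm mcar
}.

Definition mod_mor (X Y : tmodule) (f : mor X Y) : bool :=
  f ∘ mact X == mact Y ∘ fmap M f.

Record mod_hom (X Y : tmodule) := ModHom {
  mval : mor X Y;
  mvalP : mod_mor mval
}.

Section ModHom.
Variables X Y : tmodule.
HB.instance Definition _ := [isSub for @mval X Y].
HB.instance Definition _ := [Choice of mod_hom X Y by <:].

Fact mod_mor_closed : zmod_closed (@mod_mor X Y).
Proof.
split=> [|f g /eqP hf /eqP hg]; rewrite unfold_in /mod_mor.
  by rewrite cmp0m fmap0 cmpm0.
by rewrite cmpDl cmpNm hf hg fmapD fmapN cmpDr cmpmN.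
Qed.
HB.instance Definition _ :=
  GRing.isZmodClosed.Build (mor X Y) (@mod_mor X Y) mod_mor_closed.
HB.instance Definition _ :=
  [SubChoice_isSubZmodule of mod_hom X Y by <:].
End ModHom.

Fact mod_id_subproof (X : tmodule) : mod_mor (X := X) (Y := X) (idm (mcar X)).
Proof. by rewrite /mod_mor fmap1 cmp1m cmpm1. Qed.
Definition mod_id (X : tmodule) : mod_hom X X := ModHom (mod_id_subproof X).

Fact mod_comp_subproof (X Y Z : tmodule) (g : mod_hom Y Z) (f : mod_hom X Y) :
  mod_mor (X := X) (Y := Z) (mval g ∘ mval f).
Proof.
rewrite /mod_mor fmapM -cmpA (eqP (mvalP f)) !cmpA.
by rewrite (eqP (mvalP g)).
Qed.
Definition mod_comp (X Y Z : tmodule) (g : mod_hom Y Z) (f : mod_hom X Y) :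
  mod_hom X Z := ModHom (mod_comp_subproof g f).

Definition mod_category : category.
Proof.
refine (@Category tmodule (fun X Y => mod_hom X Y : zmodType) mod_id mod_comp
  _ _ _ _ _) => *; apply: val_inj => /=.
- exact: cmp1m.
- exact: cmpm1.
- exact: cmpA.
- exact: cmpDl.
- exact: cmpDr.
Defined.

Definition mod_susp_act (X : tmodule) : mor (M (susp (mcar X))) (susp (mcar X)) :=
  fmap susp (mact X) ∘ esusp M (mcar X).

Fact mod_susp_actA X :
  mod_susp_act X ∘ fmap M (mod_susp_act X) = mod_susp_act X ∘ tmul M (susp (mcar X)).
Proof.
rewrite /mod_susp_act -[RHS]cmpA tmul_susp fmapM !cmpA -fmapM -mactA fmapM.
rewrite -!cmpA; congr (_ ∘ _); rewrite !cmpA.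
congr (_ ∘ _).
exact: (esusp_nat M (mact X)).
Qed.

Fact mod_susp_act1 X : mod_susp_act X ∘ tunit M (susp (mcar X)) = idm (susp (mcar X)).
Proof. by rewrite /mod_susp_act -cmpA tunit_susp -fmapM mact1 fmap1. Qed.

Definition mod_susp_ob (X : tmodule) : tmodule :=
  TModule (mod_susp_actA X) (mod_susp_act1 X).

Fact mod_susp_mor_subproof (X Y : tmodule) (f : mod_hom X Y) :
  mod_mor (X := mod_susp_ob X) (Y := mod_susp_ob Y) (fmap susp (mval f)).
Proof.
rewrite /mod_mor /= /mod_susp_act cmpA -fmapM (eqP (mvalP f)) fmapM -!cmpA.
apply/eqP; congr (_ ∘ _); exact/esym/(esusp_nat M (mval f)).
Qed.
Definition mod_susp_mor (X Y : tmodule) (f : mod_hom X Y) :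
  mod_hom (mod_susp_ob X) (mod_susp_ob Y) := ModHom (mod_susp_mor_subproof f).

Definition mod_susp : functor mod_category mod_category.
Proof.
refine (@Functor mod_category mod_category mod_susp_ob mod_susp_mor _ _ _)
  => *; apply: val_inj => /=.
- exact: fmapD.
- exact: fmap1.
- exact: fmapM.
Defined.

Definition mod_tcategory : tcategory :=
  @TCategory mod_category mod_susp
    (fun X Y Z (f : mod_hom X Y) (g : mod_hom Y Z) (h : mod_hom Z (mod_susp_ob X)) =>
       dist (mval f) (mval g) (mval h : mor (mcar Z) (susp (mcar X)))).

End EilenbergMoore.

Section FullSubcategory.
Variables (C : tcategory) (P : C -> Prop).
Hypothesis Psusp : forall X, P X -> P (susp X).

Definition full_category : category :=
  @Category {X : C | P X} (fun X Y => mor (sval X) (sval Y))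
    (fun X => idm (sval X)) (fun X Y Z g f => g ∘ f)
    (fun X Y f => cmp1m f) (fun X Y f => cmpm1 f)
    (fun X Y Z W h g f => cmpA h g f)
    (fun X Y Z g g' f => cmpDl g g' f) (fun X Y Z g f f' => cmpDr g f f').

Section RestrictFunctor.
Variables (F : functor C C) (PF : forall X, P X -> P (F X)).

Definition full_functor : functor full_category full_category :=
  @Functor full_category full_category
    (fun X => exist P (F (sval X)) (PF (svalP X)))
    (fun X Y f => fmap F f)
    (fun X Y f g => fmapD F f g) (fun X => fmap1 F (sval X))
    (fun X Y Z g f => fmapM F g f).
End RestrictFunctor.

Definition full_tcategory : tcategory :=
  @TCategory full_category (full_functor Psusp)
    (fun X Y Z f g h => @dist C (sval X) (sval Y) (sval Z) f g h).

Variables (M : tmonad C) (PM : forall X, P X -> P (M X)).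

Definition full_exact_functor : exact_functor full_tcategory full_tcategory :=
  @ExactFunctor full_tcategory full_tcategory (full_functor PM)
    (fun X => esusp M (sval X))
    (fun X Y f => esusp_nat M f)
    (fun X => esusp_iso M (sval X))
    (fun X Y Z f g h => @efun_dist C C M (sval X) (sval Y) (sval Z) f g h).

Definition full_tmonad : tmonad full_tcategory :=
  @TMonad full_tcategory full_exact_functor
    (fun X => tmul M (sval X)) (fun X => tunit M (sval X))
    (fun X Y f => @tmul_nat C M (sval X) (sval Y) f)
    (fun X Y f => @tunit_nat C M (sval X) (sval Y) f)
    (fun X => tmulA M (sval X)) (fun X => tmul1l M (sval X))
    (fun X => tmul1r M (sval X))
    (fun X => tmul_susp M (sval X)) (fun X => tunit_susp M (sval X)).

End FullSubcategory.

(* Cohomological indexing.  Wherever the degree before a given one is needed, the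
   degrees are written n and n + 1, which avoids casts along (n - 1) + 1 = n. *)
Record complex (B : pzRingType) := Complex {
  cob :> int -> lmodType B;
  cdiff : forall n, {linear cob n -> cob (n + 1)};
  cdiffK : forall n x, cdiff (n + 1) (cdiff n x) = 0
}.

Definition acyclic (B : pzRingType) (X : complex B) : Prop :=
  forall n (x : X (n + 1)), cdiff X (n + 1) x = 0 -> exists y, cdiff X n y = x.

Section Complexes.
Variable B : pzRingType.
Implicit Types X Y Z : complex B.

Record chain_map X Y := ChainMap {
  cmap :> forall n, {linear X n -> Y n};
  cmapd : forall n x, cmap (n + 1) (cdiff X n x) = cdiff Y n (cmap n x)
}.

Section ChainMaps.
Variables X Y : complex B.

HB.instance Definition _ := gen_eqMixin (chain_map X Y).
HB.instance Definition _ := gen_choiceMixin (chain_map X Y).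

Definition homotopy (f g : chain_map X Y)
    (h : forall n, {linear X (n + 1) -> Y n}) : Prop :=
  forall n x,
    f (n + 1) x - g (n + 1) x = cdiff Y n (h n x) + h (n + 1) (cdiff X (n + 1) x).

Definition homotopic (f g : chain_map X Y) : bool :=
  `[< exists h, homotopy f g h >].

Lemma homotopicP f g : reflect (exists h, homotopy f g h) (homotopic f g).
Proof. exact: asboolP. Qed.

Lemma eq_homotopic (f g : chain_map X Y) :
  (forall n, f n =1 g n) -> homotopic f g.
Proof.
move=> fg; apply/homotopicP; exists (fun n => \0 : {linear _ -> _}) => n x.
by rewrite fg subrr /= linear0 addr0.
Qed.

Lemma homotopic_refl : reflexive homotopic.
Proof. by move=> f; apply: eq_homotopic. Qed.

Lemma homotopic_symW f g : homotopic f g -> homotopic g f.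
Proof.
move=> /homotopicP[h hh]; apply/homotopicP; exists (fun n => \- h n) => n x.
by rewrite -opprB hh opprD /= linearN.
Qed.
Lemma homotopic_sym : symmetric homotopic.
Proof. by move=> f g; apply/idP/idP; apply: homotopic_symW. Qed.

Lemma homotopic_trans : transitive homotopic.
Proof.
move=> g f k /homotopicP[h hh] /homotopicP[h' hh']; apply/homotopicP.
exists (fun n => h n \+ h' n) => n x.
by rewrite -(subrKA (g (n + 1) x)) hh hh' /= linearD addrACA.
Qed.

Canonical homotopic_equiv :=
  EquivRel homotopic homotopic_refl homotopic_sym homotopic_trans.

Definition khom : Type := {eq_quot homotopic}.
HB.instance Definition _ := Choice.on khom.
HB.instance Definition _ := Quotient.on khom.
HB.instance Definition _ := EqQuotient.on khom.

Definition kcls (f : chain_map X Y) : khom := \pi_khom f.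

Lemma kclsP f g : reflect (kcls f = kcls g) (homotopic f g).
Proof. exact: eqmodP. Qed.

Lemma kcls_eq (f g : chain_map X Y) : (forall n, f n =1 g n) -> kcls f = kcls g.
Proof. by move=> fg; apply/kclsP/eq_homotopic. Qed.

Lemma kreprK (f : khom) : kcls (repr f) = f.
Proof. exact: reprK. Qed.

Lemma krepr_homotopic (f : chain_map X Y) : homotopic (repr (kcls f)) f.
Proof. by apply/kclsP; rewrite kreprK. Qed.

Fact cm0_subproof n (x : X n) :
  (\0 : {linear X (n + 1) -> Y (n + 1)}) (cdiff X n x) =
  cdiff Y n ((\0 : {linear X n -> Y n}) x).
Proof. by rewrite /= linear0. Qed.
Definition cm0 : chain_map X Y :=
  @ChainMap X Y (fun n => \0 : {linear X n -> Y n}) cm0_subproof.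

Fact cmN_subproof (f : chain_map X Y) n (x : X n) :
  (\- f (n + 1)) (cdiff X n x) = cdiff Y n ((\- f n) x).
Proof. by rewrite /= cmapd linearN. Qed.
Definition cmN (f : chain_map X Y) : chain_map X Y :=
  @ChainMap X Y (fun n => \- f n : {linear X n -> Y n}) (cmN_subproof f).

Fact cmD_subproof (f g : chain_map X Y) n (x : X n) :
  (f (n + 1) \+ g (n + 1)) (cdiff X n x) = cdiff Y n ((f n \+ g n) x).
Proof. by rewrite /= !cmapd linearD. Qed.
Definition cmD (f g : chain_map X Y) : chain_map X Y :=
  @ChainMap X Y (fun n => f n \+ g n : {linear X n -> Y n}) (cmD_subproof f g).

Lemma cmN_homotopic f f' : homotopic f f' -> homotopic (cmN f) (cmN f').
Proof.
move=> /homotopicP[h hh]; apply/homotopicP; exists (fun n => \- h n) => n x /=.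
by rewrite -opprD hh linearN opprD.
Qed.

Lemma cmD_homotopic f f' g g' :
  homotopic f f' -> homotopic g g' -> homotopic (cmD f g) (cmD f' g').
Proof.
move=> /homotopicP[h hh] /homotopicP[k hk]; apply/homotopicP.
exists (fun n => h n \+ k n) => n x /=.
by rewrite opprD addrACA hh hk linearD addrACA.
Qed.

Definition kzero : khom := kcls cm0.
Definition kopp (f : khom) : khom := kcls (cmN (repr f)).
Definition kadd (f g : khom) : khom := kcls (cmD (repr f) (repr g)).

Lemma koppE f : kopp (kcls f) = kcls (cmN f).
Proof. exact/kclsP/cmN_homotopic/krepr_homotopic. Qed.
Lemma kaddE f g : kadd (kcls f) (kcls g) = kcls (cmD f g).
Proof. by apply/kclsP; apply: cmD_homotopic; apply: krepr_homotopic. Qed.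

Lemma kind (Q : khom -> Prop) : (forall f, Q (kcls f)) -> forall f, Q f.
Proof. by move=> hQ f; rewrite -[f]kreprK. Qed.

Fact kaddA : associative kadd.
Proof.
elim/kind => f; elim/kind => g; elim/kind => h; rewrite !kaddE.
by apply: kcls_eq => n x /=; rewrite addrA.
Qed.
Fact kaddC : commutative kadd.
Proof.
elim/kind => f; elim/kind => g; rewrite !kaddE.
by apply: kcls_eq => n x /=; rewrite addrC.
Qed.
Fact kadd0 : left_id kzero kadd.
Proof.
by elim/kind => f; rewrite kaddE; apply: kcls_eq => n x /=; rewrite add0r.
Qed.
Fact kaddN : left_inverse kzero kopp kadd.
Proof.
elim/kind => f; rewrite koppE kaddE.
by apply: kcls_eq => n x /=; rewrite addNr.
Qed.
HB.instance Definition _ := GRing.isZmodule.Build khom kaddA kaddC kadd0 kaddN.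

Lemma kclsD f g : kcls f + kcls g = kcls (cmD f g).
Proof. exact: kaddE. Qed.
End ChainMaps.

Definition cm1 X : chain_map X X :=
  @ChainMap X X (fun n => idfun : {linear X n -> X n}) (fun n x => erefl).

Fact cm_comp_subproof X Y Z (g : chain_map Y Z) (f : chain_map X Y) n (x : X n) :
  (g (n + 1) \o f (n + 1)) (cdiff X n x) = cdiff Z n ((g n \o f n) x).
Proof. by rewrite /= !cmapd. Qed.
Definition cm_comp X Y Z (g : chain_map Y Z) (f : chain_map X Y) : chain_map X Z :=
  @ChainMap X Z (fun n => g n \o f n : {linear X n -> Z n}) (cm_comp_subproof g f).

Lemma cm_comp_homotopic X Y Z (g g' : chain_map Y Z) (f f' : chain_map X Y) :
  homotopic g g' -> homotopic f f' -> homotopic (cm_comp g f) (cm_comp g' f').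
Proof.
move=> /homotopicP[k hk] /homotopicP[h hh]; apply/homotopicP.
exists (fun n => (g n \o h n) \+ (k n \o f' (n + 1))) => n x /=.
rewrite -(subrKA (g (n + 1) (f' (n + 1) x))) -linearB hh linearD cmapd hk.
rewrite cmapd linearD.
by rewrite addrACA.
Qed.

Definition kid X : khom X X := kcls (cm1 X).
Definition kcomp X Y Z (g : khom Y Z) (f : khom X Y) : khom X Z :=
  kcls (cm_comp (repr g) (repr f)).

Lemma kcompE X Y Z (g : chain_map Y Z) (f : chain_map X Y) :
  kcomp (kcls g) (kcls f) = kcls (cm_comp g f).
Proof. by apply/kclsP; apply: cm_comp_homotopic; apply: krepr_homotopic. Qed.

Definition Kcat : category.
Proof.
refine (@Category (complex B) (fun X Y => khom X Y : zmodType) kid kcomp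
  _ _ _ _ _).
- by move=> X Y; elim/kind => f; rewrite kcompE; apply: kcls_eq.
- by move=> X Y; elim/kind => f; rewrite kcompE; apply: kcls_eq.
- move=> X Y Z W; elim/kind => h; elim/kind => g; elim/kind => f.
  by rewrite !kcompE; apply: kcls_eq.
- move=> X Y Z; elim/kind => g; elim/kind => g'; elim/kind => f.
  by rewrite kclsD !kcompE kclsD; apply: kcls_eq.
- move=> X Y Z; elim/kind => g; elim/kind => f; elim/kind => f'.
  by rewrite kclsD !kcompE kclsD; apply: kcls_eq => n x /=; rewrite linearD.
Defined.

Fact shift_subproof X n (x : X (n + 1)) :
  (\- cdiff X (n + 1 + 1)) ((\- cdiff X (n + 1)) x) = 0.
Proof. by rewrite /= linearN opprK cdiffK. Qed.
Definition cshift X : complex B :=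
  @Complex B (fun n => X (n + 1))
    (fun n => \- cdiff X (n + 1) : {linear X (n + 1) -> X (n + 1 + 1)})
    (@shift_subproof X).

Fact cm_shift_subproof X Y (f : chain_map X Y) n (x : cshift X n) :
  f (n + 1 + 1) (cdiff (cshift X) n x) = cdiff (cshift Y) n (f (n + 1) x).
Proof. by rewrite /= linearN cmapd. Qed.
Definition cm_shift X Y (f : chain_map X Y) : chain_map (cshift X) (cshift Y) :=
  @ChainMap (cshift X) (cshift Y) (fun n => f (n + 1)) (cm_shift_subproof f).

Lemma cm_shift_homotopic X Y (f g : chain_map X Y) :
  homotopic f g -> homotopic (cm_shift f) (cm_shift g).
Proof.
move=> /homotopicP[h hh]; apply/homotopicP.
exists (fun n => \- h (n + 1) : {linear cshift X (n + 1) -> cshift Y n}) => n x /=.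
by rewrite hh !linearN !opprK.
Qed.

Definition kshift X Y (f : khom X Y) : khom (cshift X) (cshift Y) :=
  kcls (cm_shift (repr f)).

Lemma kshiftE X Y (f : chain_map X Y) : kshift (kcls f) = kcls (cm_shift f).
Proof. by apply/kclsP; apply: cm_shift_homotopic; apply: krepr_homotopic. Qed.

Definition Ksusp : functor Kcat Kcat.
Proof.
refine (@Functor Kcat Kcat cshift kshift _ _ _).
- move=> X Y; elim/kind => f; elim/kind => g.
  by rewrite /= kclsD !kshiftE kclsD; apply: kcls_eq.
- by move=> X; rewrite /= kshiftE; apply: kcls_eq.
- move=> X Y Z; elim/kind => g; elim/kind => f.
  by rewrite /= kcompE !kshiftE kcompE; apply: kcls_eq.
Defined.

Section Cone.
Variables (X Y : complex B) (u : chain_map X Y).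

Fact cone_diff_linear (n : int) :
  linear (fun p : (X (n + 1)%R * Y n)%type =>
    (- cdiff X (n + 1) p.1, u (n + 1) p.1 + cdiff Y n p.2)).
Proof.
move=> r p q; congr pair; rewrite /=.
  by rewrite linearP opprD scalerN.
by rewrite (linearP (u (n + 1))) (linearP (cdiff Y n)) scalerDr addrACA.
Qed.

Fact cone_diffK (n : int) (p : (X (n + 1)%R * Y n)%type) :
  Lin (@cone_diff_linear (n + 1)) (Lin (@cone_diff_linear n) p) = 0.
Proof.
congr pair; rewrite /=; first by rewrite linearN cdiffK !oppr0.
by rewrite linearN linearD cmapd cdiffK addr0 addNr.
Qed.

Definition cone : complex B :=
  @Complex B (fun n => (X (n + 1)%R * Y n)%type : lmodType B)
    (fun n => Lin (@cone_diff_linear n)) cone_diffK.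

Fact cone_in_linear n : linear (fun y : Y n => (0, y) : cone n).
Proof. by move=> r x y; congr pair; rewrite /= ?scaler0 ?addr0. Qed.
Fact cone_in_subproof n (y : Y n) :
  Lin (@cone_in_linear (n + 1)) (cdiff Y n y) = cdiff cone n (Lin (@cone_in_linear n) y).
Proof. by congr pair; rewrite /= ?linear0 ?oppr0 ?add0r. Qed.
Definition cone_in : chain_map Y cone :=
  @ChainMap Y cone (fun n => Lin (@cone_in_linear n)) cone_in_subproof.

Fact cone_out_linear n : linear (fun p : cone n => p.1 : cshift X n).
Proof. by []. Qed.
Fact cone_out_subproof n (p : cone n) :
  Lin (@cone_out_linear (n + 1)) (cdiff cone n p) =
  cdiff (cshift X) n (Lin (@cone_out_linear n) p).
Proof. by []. Qed.
Definition cone_out : chain_map cone (cshift X) :=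
  @ChainMap cone (cshift X) (fun n => Lin (@cone_out_linear n)) cone_out_subproof.
End Cone.

Definition Kdist (X Y Z : Kcat) (f : mor X Y) (g : mor Y Z) (h : mor Z (Ksusp X)) :
    Prop :=
  exists (X' Y' : complex B) (u : chain_map X' Y')
    (a : mor X (X' : Kcat)) (b : mor Y (Y' : Kcat)) (c : mor Z (cone u : Kcat)),
    [/\ is_iso a, is_iso b & is_iso c] /\
    [/\ b ∘ f = (kcls u : mor (X' : Kcat) (Y' : Kcat)) ∘ a,
        c ∘ g = (kcls (cone_in u) : mor (Y' : Kcat) (cone u : Kcat)) ∘ b
      & fmap Ksusp a ∘ h =
          (kcls (cone_out u) : mor (cone u : Kcat) (Ksusp (X' : Kcat))) ∘ c].

Definition HoCat : tcategory := @TCategory Kcat Ksusp Kdist.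

Definition acyclic_injective (X : HoCat) : Prop :=
  acyclic X /\ forall n, injective_module ((X : complex B) n).

Fact acyclic_injective_susp (X : HoCat) :
  acyclic_injective X -> acyclic_injective (susp X).
Proof.
move=> [hX iX]; split=> [n x /= hx|n]; last exact: iX.
have [|y hy] := hX (n + 1) x; first by apply/eqP; rewrite -oppr_eq0; apply/eqP.
by exists (- y); rewrite /= linearN opprK.
Qed.

Definition SingCat : tcategory := full_tcategory acyclic_injective_susp.

End Complexes.

Section TensorMonad.
Variables (R : comPzRingType) (A : algebra R).
Implicit Types X Y Z : complex R.

Fact tc_subproof X n t : tA A (cdiff X (n + 1)) (tA A (cdiff X n) t) = 0.
Proof. by rewrite tA_comp; apply: tA0 => x; apply: cdiffK. Qed.
Definition tc X : complex R :=
  @Complex R (fun n => tens (alg_mod A) (X n)) (fun n => tA A (cdiff X n))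
    (@tc_subproof X).

Fact tc_map_subproof X Y (f : chain_map X Y) n t :
  tA A (f (n + 1)) (tA A (cdiff X n) t) = tA A (cdiff Y n) (tA A (f n) t).
Proof. by rewrite !tA_comp; apply: tA_ext => x; apply: cmapd. Qed.
Definition tc_map X Y (f : chain_map X Y) : chain_map (tc X) (tc Y) :=
  @ChainMap R (tc X) (tc Y) (fun n => tA A (f n)) (tc_map_subproof f).

Lemma tc_map_homotopic X Y (f g : chain_map X Y) :
  homotopic f g -> homotopic (tc_map f) (tc_map g).
Proof.
move=> /homotopicP[h hh]; apply/homotopicP.
exists (fun n => tA A (h n) : {linear tc X (n + 1) -> tc Y n}) => n t /=.
rewrite !tA_comp -tAD -tAN -tAD; apply: tA_ext => x /=.
exact: hh.
Qed.

Definition tk X Y (f : khom X Y) : khom (tc X) (tc Y) := kcls (tc_map (repr f)).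

Lemma tkE X Y (f : chain_map X Y) : tk (kcls f) = kcls (tc_map f).
Proof. by apply/kclsP; apply: tc_map_homotopic; apply: krepr_homotopic. Qed.

Definition tfunctor : functor (HoCat R) (HoCat R).
Proof.
refine (@Functor (HoCat R) (HoCat R) tc tk _ _ _).
- move=> X Y; elim/kind => f; elim/kind => g.
  by rewrite /= kclsD !tkE kclsD; apply: kcls_eq => n t /=; rewrite -tAD; apply: tA_ext.
- by move=> X; rewrite /= tkE; apply: kcls_eq => n t; apply: tA_id.
- move=> X Y Z; elim/kind => g; elim/kind => f.
  by rewrite /= kcompE !tkE kcompE; apply: kcls_eq => n t /=; rewrite tA_comp.
Defined.

Fact tsusp_subproof X n (t : tc (cshift X) n) :
  cdiff (tc (cshift X)) n t = cdiff (cshift (tc X)) n t.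
Proof. exact: tAN. Qed.

(* A (x) X[1] and (A (x) X)[1] have the same terms, and equal differentials. *)
Definition tsusp_cm X : chain_map (tc (cshift X)) (cshift (tc X)) :=
  @ChainMap R (tc (cshift X)) (cshift (tc X)) (fun n => idfun) (@tsusp_subproof X).
Definition tsusp_cmV X : chain_map (cshift (tc X)) (tc (cshift X)) :=
  @ChainMap R (cshift (tc X)) (tc (cshift X)) (fun n => idfun)
    (fun n t => esym (tsusp_subproof t)).

Definition tsusp (X : HoCat R) : mor (tfunctor (susp X)) (susp (tfunctor X)) :=
  kcls (tsusp_cm X).

Fact tsusp_nat :
  natural (F := comp_functor tfunctor susp) (G := comp_functor susp tfunctor) tsusp.
Proof.
move=> X Y; elim/kind => f.
by rewrite /= kshiftE tkE tkE kshiftE !kcompE; apply: kcls_eq.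
Qed.

Fact tsusp_iso X : is_iso (tsusp X).
Proof.
exists (kcls (tsusp_cmV X)).
by rewrite /= !kcompE; split; apply: kcls_eq.
Qed.

Section TensorCone.
Variables (X Y : complex R) (u : chain_map X Y).
Notation C := (cone u).
Notation TC := (cone (tc_map u)).

Definition cone_fst n : {linear C n -> X (n + 1)} := Lin (@cone_out_linear _ X Y u n).
Fact cone_snd_linear n : linear (fun p : C n => p.2 : Y n).
Proof. by []. Qed.
Definition cone_snd n : {linear C n -> Y n} := Lin (@cone_snd_linear n).
Fact cone_inl_linear n : linear (fun x : X (n + 1) => (x, 0) : C n).
Proof. by move=> r x y; congr pair; rewrite /= ?scaler0 ?addr0. Qed.
Definition cone_inl n : {linear X (n + 1) -> C n} := Lin (@cone_inl_linear n).
Definition cone_inr n : {linear Y n -> C n} := Lin (@cone_in_linear _ X Y u n).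

Fact tcone_linear n :
  linear (fun t : tc C n => (tA A (cone_fst n) t, tA A (cone_snd n) t) : TC n).
Proof. by move=> r t t'; congr pair; rewrite /= linearP. Qed.
Fact tcone_subproof n (t : tc C n) :
  Lin (@tcone_linear (n + 1)) (cdiff (tc C) n t) =
  cdiff TC n (Lin (@tcone_linear n) t).
Proof.
congr pair; rewrite /= !tA_comp.
  by rewrite -tAN; apply: tA_ext.
by rewrite -tAD; apply: tA_ext.
Qed.
Definition tcone : chain_map (tc C) TC :=
  @ChainMap R (tc C) TC (fun n => Lin (@tcone_linear n)) tcone_subproof.

Fact tconeV_linear n :
  linear (fun p : TC n => tA A (cone_inl n) p.1 + tA A (cone_inr n) p.2 : tc C n).
Proof.
move=> r p q /=; rewrite (linearP (tA A (cone_inl n))).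
by rewrite (linearP (tA A (cone_inr n))) scalerDr addrACA.
Qed.

Lemma tconeK n : cancel (tcone n) (Lin (@tconeV_linear n)).
Proof.
move=> t; rewrite /= !tA_comp -tAD -[RHS]tA_id; apply: tA_ext => p /=.
by case: p => x y; congr pair; rewrite /= ?addr0 ?add0r.
Qed.
Lemma tconeVK n : cancel (Lin (@tconeV_linear n)) (tcone n).
Proof.
move=> [t t']; congr pair; rewrite /= linearD !tA_comp.
  have -> : tA A (cone_fst n \o cone_inr n) t' = 0 by apply: tA0.
  by rewrite addr0 -[RHS]tA_id; apply: tA_ext.
have -> : tA A (cone_snd n \o cone_inl n) t = 0 by apply: tA0.
by rewrite add0r -[RHS]tA_id; apply: tA_ext.
Qed.

Fact tconeV_subproof n (p : TC n) :
  Lin (@tconeV_linear (n + 1)) (cdiff TC n p) =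
  cdiff (tc C) n (Lin (@tconeV_linear n) p).
Proof.
by rewrite -{1}(tconeVK p) -cmapd tconeK.
Qed.
Definition tconeV : chain_map TC (tc C) :=
  @ChainMap R TC (tc C) (fun n => Lin (@tconeV_linear n)) tconeV_subproof.
End TensorCone.

Fact tfunctor_dist (X Y Z : HoCat R) (f : mor X Y) (g : mor Y Z)
    (h : mor Z (susp X)) :
  dist f g h ->
  dist (fmap tfunctor f) (fmap tfunctor g) (tsusp X ∘ fmap tfunctor h).
Proof.
case=> X' [Y' [u [a [b [c [[ia ib ic] [hf hg hh]]]]]]].
pose T := tfunctor.
pose theta : mor (T (cone u : HoCat R)) (cone (tc_map u) : HoCat R) := kcls (tcone u).
have itheta : is_iso theta.
  exists (kcls (tconeV u)); rewrite /theta /= !kcompE.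
  by split; apply: kcls_eq => n t; [apply: tconeK | apply: tconeVK].
have tin : theta ∘ fmap T (kcls (cone_in u) : mor (Y' : HoCat R) (cone u : HoCat R))
    = kcls (cone_in (tc_map u)).
  rewrite /theta /= tkE kcompE; apply: kcls_eq => n t.
  congr pair; rewrite /= tA_comp; first by rewrite tA0.
  by rewrite -[RHS]tA_id; apply: tA_ext.
have tout : tsusp X' ∘ fmap T (kcls (cone_out u) : mor (cone u : HoCat R) (susp (X' : HoCat R)))
    = (kcls (cone_out (tc_map u)) :
         mor (cone (tc_map u) : HoCat R) (susp (tc X' : HoCat R))) ∘ theta.
  rewrite /theta /= tkE !kcompE; apply: kcls_eq => n t /=.
  exact: tA_ext.
have tu : kcls (tc_map u) = fmap T (kcls u : mor (X' : HoCat R) (Y' : HoCat R)).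
  by rewrite /= tkE.
exists (tc X'), (tc Y'), (tc_map u), (fmap T a), (fmap T b), (theta ∘ fmap T c).
split; first by split; [| |apply: is_iso_comp => //]; apply: is_iso_fmap.
split.
- by rewrite tu -!fmapM hf.
- by rewrite -cmpA -fmapM hg fmapM cmpA tin.
- have nat_a := tsusp_nat a; rewrite cmpA -nat_a -cmpA.
  by rewrite [fmap (comp_functor _ _) _]/= -fmapM hh fmapM cmpA tout -cmpA.
Qed.

Definition texact : exact_functor (HoCat R) (HoCat R) :=
  @ExactFunctor (HoCat R) (HoCat R) tfunctor tsusp tsusp_nat tsusp_iso tfunctor_dist.

Fact tmul_subproof X n (t : tc (tc X) n) :
  tact A (X (n + 1)) (cdiff (tc (tc X)) n t) = cdiff (tc X) n (tact A (X n) t).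
Proof. exact: tact_nat. Qed.
Definition tmul_cm X : chain_map (tc (tc X)) (tc X) :=
  @ChainMap R (tc (tc X)) (tc X) (fun n => tact A (X n)) (@tmul_subproof X).

Fact tunit_subproof X n (x : X n) :
  ins A (X (n + 1)) (cdiff X n x) = cdiff (tc X) n (ins A (X n) x).
Proof. by rewrite /= ins_nat. Qed.
Definition tunit_cm X : chain_map X (tc X) :=
  @ChainMap R X (tc X) (fun n => ins A (X n)) (@tunit_subproof X).

Definition tensor_monad : tmonad (HoCat R).
Proof.
refine (@TMonad (HoCat R) texact (fun X => kcls (tmul_cm X))
  (fun X => kcls (tunit_cm X)) _ _ _ _ _ _ _).
- move=> X Y; elim/kind => f; rewrite /= !tkE !kcompE.
  by apply: kcls_eq => n t; apply: tact_nat.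
- move=> X Y; elim/kind => f; rewrite /= !tkE !kcompE.
  by apply: kcls_eq => n t /=; rewrite ins_nat.
- move=> X; rewrite /= !tkE !kcompE; apply: kcls_eq => n t; exact: tact_assoc.
- move=> X; rewrite /= !kcompE; apply: kcls_eq => n t; exact: tact_ins.
- move=> X; rewrite /= !tkE !kcompE; apply: kcls_eq => n t; exact: tact_tA_ins.
- move=> X; rewrite /= /tsusp !(tkE, kshiftE) !kcompE; apply: kcls_eq => n t /=.
  by rewrite tA_id.
- by move=> X; rewrite /= /tsusp !kshiftE !kcompE; apply: kcls_eq.
Defined.

(* The monad A (x)_R - on K(R) restricts to the full subcategory S(R). *)
Definition tensor_stable : Prop :=
  forall X : HoCat R, acyclic_injective X -> acyclic_injective (tensor_monad X).

Definition ModSing (stab : tensor_stable) : tcategory :=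
  mod_tcategory (full_tmonad (@acyclic_injective_susp R) stab).

End TensorMonad.

(* Main.v *)
(* Restriction of scalars along R -> A sends a complex of injective A-modules X to
   an A (x) - -module with action A (x) X -> X.  Let sum a_i (x) b_i be the separability
   element.  Averaging, f |-> sum a_i f(b_i -), turns R-linear maps and homotopies
   into A-linear ones, so this functor is full and faithful, and an A-module that
   is injective over R is injective.  Every (X, alpha) is a retract of the free
   module A (x) X, whose terms are injective over R by flatness and Baer's criterion,
   hence over A; so it remains to split idempotents in S(A).  An idempotent e on Z
   splits through the cone of an endomorphism of the countable product of copies
   of Z: countable products of acyclic complexes of injectives are again such. *)

From HB Require Import structures.
From mathcomp Require Import all_boot all_algebra.
From mathcomp Require Import boolp classical_sets functions.
Require Import Defs.

Set Implicit Arguments.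
Unset Strict Implicit.
Unset Printing Implicit Defensive.

Import GRing.Theory.
Local Open Scope ring_scope.
Local Open Scope quotient_scope.

(** * Quotient modules *)

(** Three obstacles shape the proof. An object of the module category carries an action that is
    associative and unital only up to homotopy, so no A-module structure can be read off it
    termwise; the detour through the free module and a split idempotent replaces such a
    strictification. For the same reason a morphism of modules commutes with the actions only up to
    homotopy; its average is compared with it by writing the average as action o (A (x) g) o
    section, a composite in which that homotopy can be applied. Finally A need not be finitely
    generated over R, so A (x) E need not be a summand of a finite sum of copies of E; its
    injectivity rests on the finite presentation of the ideals of R, to which Baer's criterion
    reduces the question. Exactness is immediate: restriction leaves cones and shifts unchanged on
    elements, and triangles of modules are tested on the underlying triangles. *)

Definition submodule (B : pzRingType) (V : lmodType B) (N : V -> Prop) : Prop :=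
  [/\ N 0, forall x y, N x -> N y -> N (x + y) & forall a x, N x -> N (a *: x)].

Lemma submoduleB (B : pzRingType) (V : lmodType B) (N : V -> Prop) x y :
  submodule N -> N x -> N y -> N (x - y).
Proof. by move=> [_ hD hZ] hx hy; rewrite -scaleN1r; apply/hD/hZ. Qed.

Section QuotientModule.
Variables (B : pzRingType) (V : lmodType B) (N : V -> Prop).
Hypothesis hN : submodule N.

Definition quo_equiv (x y : V) : bool := `[< N (x - y) >].

Lemma quo_equiv_refl : reflexive quo_equiv.
Proof. by case: hN => h0 _ _ x; apply/asboolP; rewrite subrr. Qed.

Lemma quo_equiv_sym : symmetric quo_equiv.
Proof.
case: hN => h0 hD hZ x y; apply/asboolP/asboolP => /(hZ (-1));
  by rewrite scaleN1r opprB.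
Qed.

Lemma quo_equiv_trans : transitive quo_equiv.
Proof.
case: hN => h0 hD hZ y x z /asboolP h1 /asboolP h2; apply/asboolP.
by rewrite -(subrKA y); apply: hD.
Qed.

Canonical quo_equiv_rel :=
  EquivRel quo_equiv quo_equiv_refl quo_equiv_sym quo_equiv_trans.

Definition quo : Type := {eq_quot quo_equiv}.
HB.instance Definition _ := Choice.on quo.
HB.instance Definition _ := Quotient.on quo.
HB.instance Definition _ := EqQuotient.on quo.

Lemma quo_piP (x y : V) : (\pi_quo x = \pi_quo y) <-> N (x - y).
Proof. by split=> [/eqmodP/asboolP|h]; last exact/eqmodP/asboolP. Qed.

Lemma quo_repr (x : V) : N (repr (\pi_quo x) - x).
Proof. by apply/quo_piP; rewrite reprK. Qed.

Definition quo_add (u v : quo) : quo := \pi_quo (repr u + repr v).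
Definition quo_opp (u : quo) : quo := \pi_quo (- repr u).
Definition quo_scale (a : B) (u : quo) : quo := \pi_quo (a *: repr u).

Lemma quo_addE x y : quo_add (\pi_quo x) (\pi_quo y) = \pi_quo (x + y).
Proof.
by apply/quo_piP; rewrite opprD addrACA; case: hN => _ hD _; apply: hD; apply: quo_repr.
Qed.

Lemma quo_oppE x : quo_opp (\pi_quo x) = \pi_quo (- x).
Proof.
apply/quo_piP; case: hN => _ _ hZ.
by rewrite opprK addrC -opprB -scaleN1r; apply: hZ; apply: quo_repr.
Qed.

Lemma quo_scaleE a x : quo_scale a (\pi_quo x) = \pi_quo (a *: x).
Proof.
by apply/quo_piP; rewrite -scalerBr; case: hN => _ _ hZ; apply: hZ; apply: quo_repr.
Qed.

Lemma quo_ind (Q : quo -> Prop) : (forall x, Q (\pi_quo x)) -> forall u, Q u.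
Proof. by move=> h u; rewrite -[u]reprK. Qed.

Fact quo_addA : associative quo_add.
Proof.
by elim/quo_ind=> x; elim/quo_ind=> y; elim/quo_ind=> z; rewrite !quo_addE addrA.
Qed.
Fact quo_addC : commutative quo_add.
Proof. by elim/quo_ind=> x; elim/quo_ind=> y; rewrite !quo_addE addrC. Qed.
Fact quo_add0 : left_id (\pi_quo 0) quo_add.
Proof. by elim/quo_ind=> x; rewrite quo_addE add0r. Qed.
Fact quo_addN : left_inverse (\pi_quo 0) quo_opp quo_add.
Proof. by elim/quo_ind=> x; rewrite quo_oppE quo_addE addNr. Qed.
HB.instance Definition _ :=
  GRing.isZmodule.Build quo quo_addA quo_addC quo_add0 quo_addN.

Fact quo_scaleA a b u : quo_scale a (quo_scale b u) = quo_scale (a * b) u.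
Proof. by elim/quo_ind: u => x; rewrite !quo_scaleE scalerA. Qed.
Fact quo_scale1 : left_id 1 quo_scale.
Proof. by elim/quo_ind=> x; rewrite quo_scaleE scale1r. Qed.
Fact quo_scaleDr : right_distributive quo_scale +%R.
Proof.
move=> a; elim/quo_ind=> x; elim/quo_ind=> y.
by rewrite [_ + _]quo_addE !quo_scaleE [RHS]quo_addE scalerDr.
Qed.
Fact quo_scaleDl u : {morph quo_scale^~ u : a b / a + b}.
Proof.
by move=> a b; elim/quo_ind: u => x; rewrite !quo_scaleE [RHS]quo_addE scalerDl.
Qed.
HB.instance Definition _ :=
  GRing.Zmodule_isLmodule.Build B quo
    quo_scaleA quo_scale1 quo_scaleDr quo_scaleDl.

Fact quo_pi_linear : linear (fun x : V => \pi_quo x : quo).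
Proof. by move=> a x y; rewrite [X in _ = X + _]quo_scaleE [RHS]quo_addE. Qed.
Definition quo_pi : {linear V -> quo} := Lin quo_pi_linear.

Lemma quo_pi_eq0 x : quo_pi x = 0 <-> N x.
Proof. by rewrite -[X in N X]subr0; apply: quo_piP. Qed.

Section Lift.
Variables (W : lmodType B) (f : {linear V -> W}).
Hypothesis hf : forall x, N x -> f x = 0.

Lemma quo_reprE x : f (repr (\pi_quo x)) = f x.
Proof. by apply/eqP; rewrite -subr_eq0 -linearB; apply/eqP/hf/quo_repr. Qed.

Fact quo_lift_linear : linear (fun u : quo => f (repr u)).
Proof.
move=> a; elim/quo_ind=> x; elim/quo_ind=> y.
by rewrite [a *: _]quo_scaleE [_ + _]quo_addE !quo_reprE linearP.
Qed.
Definition quo_lift : {linear quo -> W} := Lin quo_lift_linear.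

Lemma quo_liftE x : quo_lift (quo_pi x) = f x.
Proof. exact: quo_reprE. Qed.
End Lift.
End QuotientModule.

Lemma submodule_ker (B : pzRingType) (V W : lmodType B) (f : {linear V -> W}) :
  submodule (fun x => f x = 0).
Proof.
split=> [|x y hx hy|a x hx]; first exact: linear0.
  by rewrite linearD hx hy addr0.
by rewrite linearZ_LR hx scaler0.
Qed.

Lemma quo_lift_ker_inj (B : pzRingType) (V W : lmodType B) (f : {linear V -> W}) :
  injective (quo_lift (submodule_ker f) (fun x (hx : f x = 0) => hx)).
Proof.
apply: (quo_ind (N := fun x => f x = 0)) => x.
apply: (quo_ind (N := fun x => f x = 0)) => y.
rewrite [X in X = _ -> _]quo_liftE [X in _ = X -> _]quo_liftE => h.
by apply/quo_piP; rewrite linearB h subrr.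
Qed.

(** * Flatness and Baer's criterion *)

Section FlatKernel.
Variables (R : comPzRingType) (M X Y : lmodType R) (f : {linear X -> Y}).

(** The image of M (x) ker f in M (x) X, given by lists of pure tensors so that ker f need not be
    made into a module. *)
Definition tens_ker (u : tens M X) : Prop :=
  exists s : seq (M * X),
    u = \sum_(p <- s) tpure p.1 p.2 /\ forall p, p \in s -> f p.2 = 0.

Lemma tens_ker_submodule : submodule tens_ker.
Proof.
split=> [|u v [s [-> hs]] [t [-> ht]]|a u [s [-> hs]]].
- by exists [::]; rewrite big_nil.
- exists (s ++ t); rewrite big_cat; split=> // p.
  by rewrite mem_cat => /orP[/hs|/ht].
- exists [seq (a *: p.1, p.2) | p <- s]; split; last by move=> p /mapP[q /hs h ->].
  rewrite scaler_sumr big_map; apply: eq_bigr => p _ /=.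
  by rewrite (bilinZl (tpure_bilin M X)).
Qed.

Lemma tens_ker_pure m x : f x = 0 -> tens_ker (tpure m x).
Proof.
move=> hx; exists [:: (m, x)]; rewrite big_seq1; split=> // p.
by rewrite inE => /eqP->.
Qed.

Let Q := quo tens_ker_submodule.
Let C := quo (submodule_ker f).
Let piQ : {linear tens M X -> Q} := quo_pi tens_ker_submodule.
Let piC : {linear X -> C} := quo_pi (submodule_ker f).

Let bX m : {linear X -> Q} := piQ \o Lin ((tpure_bilin M X).1 m).

Fact tens_ker_lift_subproof m x : f x = 0 -> bX m x = 0.
Proof. by move=> hx; apply/quo_pi_eq0/tens_ker_pure. Qed.

Let bC m : {linear C -> Q} :=
  quo_lift (submodule_ker f) (@tens_ker_lift_subproof m).

Fact tens_ker_lift_bilin : bilin (fun m => bC m).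
Proof.
split=> [m|c]; first exact: linearP.
elim/quo_ind: c => x r m m'.
rewrite !(quo_liftE _ (@tens_ker_lift_subproof _)).
rewrite -[RHS]/(r *: piQ (tpure m x) + piQ (tpure m' x)) -linearP; congr (piQ _).
exact: (tpure_bilin M X).2.
Qed.

(* Injectivity of M (x) (X / ker f) -> M (x) Y reduces the claim to right
   exactness: (M (x) X) / N receives a map from M (x) (X / ker f). *)
Lemma flat_ker : flat_module M ->
  forall u, tmap (idfun : {linear M -> M}) f u = 0 -> tens_ker u.
Proof.
move=> flatM u hu; apply/(quo_pi_eq0 tens_ker_submodule).
pose fC := quo_lift (submodule_ker f) (fun x (hx : f x = 0) => hx).
have hpi : tmap idfun piC u = 0.
  apply: (flatM _ _ fC); first exact: quo_lift_ker_inj.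
  rewrite linear0 -[RHS]hu.
  apply: (tens_ext (f := tmap idfun fC \o tmap idfun piC)) => m x /=.
  by rewrite !tmapE [fC _](quo_liftE _ (fun x (hx : f x = 0) => hx)).
have := tens_ext (f := tlift tens_ker_lift_bilin \o tmap idfun piC) (g := piQ).
move=> /(_ _ u) /= <-; first by rewrite hpi linear0.
move=> m x; rewrite tmapE tliftE.
exact: (quo_liftE _ (@tens_ker_lift_subproof m)).
Qed.
End FlatKernel.

Section Baer.
Variables (B : pzRingType) (E : lmodType B).

(* [G] is the graph of a linear map to E from a submodule of V. *)
Definition linear_graph (V : lmodType B) (G : V -> E -> Prop) : Prop :=
  [/\ G 0 0, forall x e x' e', G x e -> G x' e' -> G (x + x') (e + e'),
      forall a x e, G x e -> G (a *: x) (a *: e) & forall e, G 0 e -> e = 0].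

Lemma linear_graphB (V : lmodType B) (G : V -> E -> Prop) x e x' e' :
  linear_graph G -> G x e -> G x' e' -> G (x - x') (e - e').
Proof.
by move=> [_ hD hZ _] h h'; rewrite -(scaleN1r x') -(scaleN1r e'); apply/hD/hZ.
Qed.

Lemma linear_graph_eq (V : lmodType B) (G : V -> E -> Prop) x e e' :
  linear_graph G -> G x e -> G x e' -> e = e'.
Proof.
move=> hG h h'; have [_ _ _ h0] := hG; apply/eqP; rewrite -subr_eq0; apply/eqP/h0.
by rewrite -(subrr x); apply: linear_graphB.
Qed.

(** The ideal is the domain of [G]; a linear map from B to E is r |-> r w, so extending [G] to B
    amounts to finding w. *)
Definition Baer_condition : Prop :=
  forall G : B^o -> E -> Prop, linear_graph G ->
    exists w : E, forall (r : B) e, G r e -> e = r *: w.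

(** The scalars r with r v in the domain of [G] form an ideal, and r |-> G(r v) is linear on it; the
    condition gives the value w to be assigned to v. *)
Lemma Baer_extend (V : lmodType B) (G : V -> E -> Prop) (v : V) :
  Baer_condition -> linear_graph G ->
  exists w, linear_graph (fun x e => exists y d r,
    [/\ G y d, x = y + r *: v & e = d + r *: w]).
Proof.
move=> baer hG; have [h0 hD hZ hf] := hG.
have [|w hw] := baer (fun (r : B) e => G (r *: v) e).
  split=> [|r e r' e' h h'|a r e /(hZ a)|e].
  - by rewrite scale0r.
  - by rewrite scalerDl; apply: hD.
  - by rewrite scalerA.
  - by rewrite scale0r; apply: hf.
exists w; split=> [|x e x' e'|a x e|e].
- by exists 0, 0, 0; rewrite !scale0r !addr0.
- move=> [y [d [r [h -> ->]]]] [y' [d' [r' [h' -> ->]]]].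
  exists (y + y'), (d + d'), (r + r').
  by split; rewrite ?scalerDl 1?addrACA //; apply: hD.
- move=> [y [d [r [h -> ->]]]]; exists (a *: y), (a *: d), (a * r).
  by rewrite !scalerDr !scalerA; split=> //; apply: hZ.
(* Here y + r v = 0, so [G] relates (- r) v to d and the choice of w forces d = - r w. *)
- move=> [y [d [r [h e0 ->]]]]; rewrite (hw (- r) d) ?scaleNr ?addNr //.
  by have := h; rewrite (_ : y = - (r *: v)) // -[RHS]sub0r [in RHS]e0 addrK.
Qed.

Lemma Baer : Baer_condition -> injective_module E.
Proof.
move=> baer U V i f inji.
pose G0 (p : V * E) := exists u, p = (i u, f u).
pose good (G : set (V * E)) := linear_graph (fun x e => G (x, e)) /\ forall p, G0 p -> G p.
(* The union of the empty chain is empty and is no linear graph, so Zorn's lemma is applied to a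
   predicate that also admits the empty set; the maximal element is shown to be good afterwards. *)
pose P (G : set (V * E)) := (forall p, ~ G p) \/ good G.
have goodG0 : good G0.
  split=> //; split=> [|x e x' e' [u [-> ->]] [u' [-> ->]]|a x e [u [-> ->]]|e].
  - by exists 0; rewrite !linear0.
  - by exists (u + u'); rewrite !linearD.
  - by exists (a *: u); rewrite !linearZ.
  - by move=> [u [/esym e0 ->]]; rewrite (inji u 0) ?linear0.
have [F hFP hF|G [PG maxG]] := @Zorn_bigcup _ P.
  have [[G FG [p Gp]]|hno] := pselect (exists2 G, F G & exists p, G p); last first.
    by left=> p [G FG Gp]; apply: hno; exists G => //; exists p.
  have goodF H q : F H -> H q -> good H.
    by move=> FH Hq; case: (hFP H FH) => // /(_ q).
  have [gG G0G] := goodF _ _ FG Gp; right; split; last first.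
    by move=> q /G0G Gq; exists G.
  split=> [|x e x' e' [H FH h] [H' FH' h']|a x e [H FH h]|e [H FH h]].
  - by exists G => //; case: gG.
  - case: (hF _ _ FH FH') => sub.
      by exists H' => //; case: (goodF _ _ FH' h') => -[_ hD _ _] _; apply/hD/h'/sub.
    by exists H => //; case: (goodF _ _ FH h) => -[_ hD _ _] _; apply/hD/sub.
  - by exists H => //; case: (goodF _ _ FH h) => -[_ _ hZ _] _; apply: hZ.
  - by case: (goodF _ _ FH h) => -[_ _ _ hf] _; apply: hf.
have [lG G0G] : good G.
  case: PG => // G_empty; case: (maxG G0); last by right.
  split=> [p /G_empty //|]; apply: contra_notP (G_empty (i 0, f 0)) => h.
  by exfalso; apply: h => sub; apply: (G_empty (i 0, f 0)); apply: sub; exists 0.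
have tot v : exists e, G (v, e).
  have [w hw] := Baer_extend v baer lG.
  pose G' (p : V * E) := exists y d r,
    [/\ G (y, d), p.1 = y + r *: v & p.2 = d + r *: w].
  have [h0 _ _ _] := lG.
  have GG' p : G p -> G' p.
    by case: p => x e Gp; exists x, e, 0; rewrite !scale0r !addr0.
  have [sub|nsub] := pselect (forall p, G' p -> G p).
    by exists w; apply: sub; exists 0, 0, 1; rewrite !scale1r !add0r.
  exfalso; apply: (maxG G'); first by split.
  by right; split=> // p /G0G/GG'.
pose g v := sval (cid (tot v)).
have hg v : G (v, g v) by rewrite /g; case: cid.
have lin_g : linear g.
  move=> a x y; have [_ hD hZ _] := lG.
  by apply: (linear_graph_eq lG (hg _)); apply: hD => //; apply: hZ.
exists (Lin lin_g) => u; apply: (linear_graph_eq lG (hg _)); apply: G0G.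
by exists u.
Qed.
End Baer.

(** * Noetherian rings *)

(** If no finite list generated J, adjoining again and again an element of J outside the current
    span would give a chain of ideals that never stops. The span is the intersection of all left
    ideals containing the list, which avoids explicit linear combinations. *)
Lemma left_ideal_fg (B : pzRingType) (J : B -> Prop) :
  left_noetherian B -> left_ideal J ->
  exists s : seq B, (forall x, x \in s -> J x) /\
    forall P, left_ideal P -> (forall x, x \in s -> P x) -> forall x, J x -> P x.
Proof.
move=> acc idJ; apply: contrapT => hno.
pose span (s : seq B) x :=
  forall P, left_ideal P -> (forall y, y \in s -> P y) -> P x.
have step s : exists x, (forall y, y \in s -> J y) -> J x /\ ~ span s x.
  have [hs|hs] := pselect (forall y, y \in s -> J y); last by exists 0.
  apply: contrapT => h; apply: hno; exists s; split=> // P idP sP x Jx.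
  by apply: contrapT => nPx; apply: h; exists x => _; split=> // /(_ P idP sP).
pose next s := sval (cid (step s)).
have hnext s : (forall y, y \in s -> J y) -> J (next s) /\ ~ span s (next s).
  by rewrite /next; case: cid.
pose t := fix t k := if k is k'.+1 then next (t k') :: t k' else [::].
have Jt k y : y \in t k -> J y.
  elim: k y => [|k IH] y //=; rewrite inE => /orP[/eqP->|/IH//].
  by case: (hnext _ IH).
have [||k hk] := acc (fun k => span (t k)).
- move=> k; split=> [P [h0 _ _] _ //|x y hx hy P idP sP|a x hx P idP sP];
    case: (idP) => _ hD hM.
    by apply: hD; [apply: hx | apply: hy].
  by apply: hM; apply: hx.
- move=> k x hx P idP sP; apply: hx => // y hy; apply: sP.
  by rewrite /= inE hy orbT.
have [_] := hnext _ (@Jt k); apply; apply: (hk k.+1 _ (leqnSn k)) => P _; apply.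
by rewrite /= inE eqxx.
Qed.

(** A single type serves both as V^n for every n, with no dependent types in n, and as the countable
    power used to split idempotents. *)
Definition seqmod (R : pzRingType) (V : lmodType R) : Type := nat -> V.
HB.instance Definition _ (R : pzRingType) (V : lmodType R) :=
  GRing.Lmodule.copy (seqmod V) (nat -> V).

Section Seqmod.
Variables (R : pzRingType) (V W : lmodType R).

Lemma seqmod_addE (c d : seqmod V) i : (c + d) i = c i + d i. Proof. by []. Qed.
Lemma seqmod_scaleE a (c : seqmod V) i : (a *: c) i = a *: c i. Proof. by []. Qed.

Lemma seqmod_subE (c d : seqmod V) i : (c - d) i = c i - d i. Proof. by []. Qed.

Fact seq_ev_linear i : linear (fun c : seqmod V => c i). Proof. by []. Qed.
Definition seq_ev i : {linear seqmod V -> V} := Lin (seq_ev_linear i).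

Definition seq_in_fun (i : nat) (x : V) : seqmod V := fun j => if j == i then x else 0.
Fact seq_in_linear i : linear (seq_in_fun i).
Proof.
move=> a x y; apply/funext => j; rewrite seqmod_addE seqmod_scaleE /seq_in_fun.
by case: eqP; rewrite ?scaler0 ?addr0.
Qed.
Definition seq_in i : {linear V -> seqmod V} := Lin (seq_in_linear i).

Lemma seq_inE i x j : seq_in i x j = if j == i then x else 0. Proof. by []. Qed.

Definition seq_prod (f : nat -> {linear W -> V}) (n : nat) (x : W) : seqmod V :=
  \sum_(i < n) seq_in i (f i x).
Fact seq_prod_linear f n : linear (seq_prod f n).
Proof.
move=> a x y; rewrite /seq_prod scaler_sumr -big_split; apply: eq_bigr => i _.
by rewrite !linearP.
Qed.
Definition seq_tuple f n : {linear W -> seqmod V} := Lin (seq_prod_linear f n).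

Lemma seq_tupleE f n x j : seq_tuple f n x j = if (j < n)%N then f j x else 0.
Proof.
rewrite -[LHS]/(seq_ev j (\sum_(i < n) seq_in i (f i x))) linear_sum /=.
rewrite (eq_bigr (fun i : 'I_n => if j == i then f j x else 0)); last first.
  by move=> i _; rewrite /seq_in_fun; case: eqP => // ->.
rewrite -big_mkcond /=; case: ltnP => h; last first.
  by rewrite big_pred0 // => i; apply/eqP => e; move: (ltn_ord i); rewrite -e ltnNge h.
by rewrite (big_pred1 (Ordinal h)).
Qed.
End Seqmod.

Section Noetherian.
Variables (R : pzRingType).
Hypothesis noethR : left_noetherian R.

(* Sequences stand for the elements of R^n: a submodule of R^n is a submodule of
   R^nat, read modulo the sequences that vanish on the first n terms. *)
Lemma submodule_fg n (N : seqmod R^o -> Prop) : submodule N ->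
  exists L : seq (seqmod R^o), (forall c, c \in L -> N c) /\
    forall Q, submodule Q -> (forall c, c \in L -> Q c) ->
      (forall c : seqmod R^o, (forall i, (i < n)%N -> c i = 0) -> Q c) ->
      forall c, N c -> Q c.
Proof.
elim: n N => [|n IH] N hN; have [N0 ND NZ] := hN.
  by exists [::]; split=> // Q hQ _ hv c _; apply: hv.
(* Generators of the ideal of n-th coordinates are lifted to [N]; the part of [N] with vanishing
   n-th coordinate is left to the induction hypothesis. *)
have [|s [sJ hs]] := left_ideal_fg (J := fun r => exists2 c, N c & c n = r) noethR.
  split=> [|x y [c hc <-] [d hd <-]|a x [c hc <-]].
  - by exists 0.
  - by exists (c + d) => //; apply: ND.
  - by exists (a *: c) => //; apply: NZ.
have [lift hlift] : exists lift : R -> seqmod R^o,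
    forall x, x \in s -> N (lift x) /\ lift x n = x.
  pose lf x := xget (0 : seqmod R^o) (fun c => N c /\ c n = x).
  exists lf => x /sJ[c Nc hc].
  exact: (@xgetPex _ 0 (fun c => N c /\ c n = x) (ex_intro _ c (conj Nc hc))).
have [|L [LN hL]] := IH (fun c => N c /\ c n = 0).
  split=> [//|x y [hx ex] [hy ey]|a x [hx ex]].
    by split; [apply: ND | rewrite seqmod_addE ex ey addr0].
  by split; [apply: NZ | rewrite seqmod_scaleE ex scaler0].
exists (map lift s ++ L); split=> [c|Q hQ LQ vQ].
  by rewrite mem_cat => /orP[/mapP[x xs ->]|/LN[]//]; case: (hlift x xs).
have [Q0 QD QZ] := hQ.
have N'Q c : N c -> c n = 0 -> Q c.
  (* The induction hypothesis wants a submodule containing every sequence that vanishes below n,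
     whereas [Q] is only known to contain those that also vanish at n. Testing [Q] after erasing the
     n-th coordinate bridges this gap. *)
  move=> Nc cn; pose cut (d : seqmod R^o) : seqmod R^o := d - seq_in R^o n (d n).
  have cut_id d : d n = 0 -> cut d = d.
    by move=> dn; rewrite /cut dn linear0 subr0.
  rewrite -(cut_id c cn); apply: (hL (fun d => Q (cut d))) => //; last 1 first.
  - move=> d hd; apply: vQ => i; rewrite ltnS leq_eqVlt => /orP[/eqP->|lt_in].
      by rewrite /cut seqmod_subE seq_inE eqxx subrr.
    by rewrite /cut seqmod_subE seq_inE (ltn_eqF lt_in) hd // subr0.
  - split=> [|x y hx hy|a x hx].
    + by rewrite /cut linear0 subr0.
    + by rewrite /cut linearD opprD addrACA; apply: QD.
    + by rewrite /cut linearZ_LR -scalerBr; apply: QZ.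
  - by move=> d /[dup] dL /LN[_ dn]; rewrite cut_id //; apply: LQ; rewrite mem_cat dL orbT.
move=> c Nc.
have [d [Nd Qd dn]] : exists d, [/\ N d, Q d & d n = c n].
  apply: (hs (fun r => exists d, [/\ N d, Q d & d n = r])); last by exists c.
  - split=> [|x y [d [Nd Qd <-]] [d' [Nd' Qd' <-]]|a x [d [Nd Qd <-]]].
    + by exists 0.
    + by exists (d + d'); split=> //; [apply: ND | apply: QD].
    + by exists (a *: d); split=> //; [apply: NZ | apply: QZ].
  - move=> x xs; case: (hlift x xs) => h1 h2; exists (lift x); split=> //.
    by apply: LQ; rewrite mem_cat map_f.
rewrite -(subrK d c); apply: QD => //; apply: N'Q; first exact: submoduleB.
by rewrite seqmod_subE dn subrr.
Qed.
End Noetherian.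

(** * Tensoring an injective module with a flat module *)

Section TensorInjective.
Variables (R : comPzRingType).

Definition lincomb (V : lmodType R) n (c : seqmod R^o) (h : seqmod V) : V :=
  \sum_(i < n) (c i : R) *: h i.

Fact lincomb_linearl (V : lmodType R) n (h : seqmod V) : linear (fun c => lincomb n c h).
Proof.
move=> a c d; rewrite /lincomb scaler_sumr -big_split; apply: eq_bigr => i _ /=.
by rewrite scalerA -scalerDl.
Qed.
Definition lincombl (V : lmodType R) n (h : seqmod V) : {linear seqmod R^o -> V} :=
  Lin (lincomb_linearl n h).

Fact lincomb_linearr (V : lmodType R) n (c : seqmod R^o) : linear (@lincomb V n c).
Proof.
move=> a h k; rewrite /lincomb scaler_sumr -big_split; apply: eq_bigr => i _ /=.
by rewrite scalerDr !scalerA mulrC.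
Qed.
Definition lincombr (V : lmodType R) n (c : seqmod R^o) : {linear seqmod V -> V} :=
  Lin (@lincomb_linearr V n c).

Lemma lincomb_inl (V : lmodType R) n i a (h : seqmod V) : (i < n)%N ->
  lincomb n (seq_in R^o i a) h = a *: h i.
Proof.
move=> lt_in; rewrite /lincomb (bigD1 (Ordinal lt_in)) //= big1 ?addr0.
  by rewrite /seq_in_fun eqxx.
by move=> j /eqP ne_ji; rewrite /seq_in_fun; case: eqP => [e|_]; rewrite ?scale0r //;
  case: ne_ji; apply: val_inj.
Qed.

Lemma lincomb_inr (V : lmodType R) n i c (x : V) : (i < n)%N ->
  lincomb n c (seq_in V i x) = (c i : R) *: x.
Proof.
move=> lt_in; rewrite /lincomb (bigD1 (Ordinal lt_in)) //= big1 ?addr0.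
  by rewrite /seq_in_fun eqxx.
by move=> j /eqP ne_ji; rewrite /seq_in_fun; case: eqP => [e|_]; rewrite ?scaler0 //;
  case: ne_ji; apply: val_inj.
Qed.

Variables (M E : lmodType R).

Lemma tmapr_sum (X Y : lmodType R) n (f : 'I_n -> {linear X -> Y})
    (g : {linear X -> Y}) (u : tens M X) :
  (forall x, g x = \sum_i f i x) ->
  tmap (idfun : {linear M -> M}) g u = \sum_i tmap (idfun : {linear M -> M}) (f i) u.
Proof.
move=> gE.
have lin : linear (fun u : tens M X => \sum_i tmap (idfun : {linear M -> M}) (f i) u).
  move=> a v w; rewrite scaler_sumr -big_split; apply: eq_bigr => i _.
  by rewrite linearP.
apply: (tens_ext (g := Lin lin)) => m x /=; rewrite tmapE gE.
rewrite -[LHS]/(Lin ((tpure_bilin M Y).1 m) _) linear_sum.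
by apply: eq_bigr => i _; rewrite tmapE.
Qed.

Lemma tmapr_comp (X Y Z : lmodType R) (g : {linear Y -> Z}) (f : {linear X -> Y}) u :
  tmap (idfun : {linear M -> M}) g (tmap (idfun : {linear M -> M}) f u) =
  tmap (idfun : {linear M -> M}) (g \o f) u.
Proof.
apply: (tens_ext (f := tmap (idfun : {linear M -> M}) g \o tmap idfun f)) => m x /=.
by rewrite !tmapE.
Qed.

Lemma tmapr_scale (X Y : lmodType R) (a : R) (g : {linear X -> Y}) (f : {linear X -> Y}) u :
  (forall x, g x = a *: f x) ->
  tmap (idfun : {linear M -> M}) g u = a *: tmap (idfun : {linear M -> M}) f u.
Proof.
move=> gE.
have lin : linear (fun u => a *: tmap (idfun : {linear M -> M}) f u).
  by move=> b v w; rewrite linearP scalerDr !scalerA mulrC.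
apply: (tens_ext (g := Lin lin)) => m x /=; rewrite !tmapE gE.
exact: (linearZ_LR (Lin ((tpure_bilin M Y).1 m))).
Qed.

Lemma tmapr_id (X : lmodType R) (g : {linear X -> X}) u : g =1 id ->
  tmap (idfun : {linear M -> M}) g u = u.
Proof.
move=> gE; apply: (tens_ext (g := (idfun : {linear _ -> _}))) => m x.
by rewrite tmapE gE.
Qed.

Lemma tmapr0 (X Y : lmodType R) (g : {linear X -> Y}) u : (forall x, g x = 0) ->
  tmap (idfun : {linear M -> M}) g u = 0.
Proof.
move=> gE; apply: (tens_ext (g := \0)) => m x.
by rewrite tmapE gE; apply: (linear0 (Lin ((tpure_bilin M Y).1 m))).
Qed.

(* A tuple h in E^n killed by every relation between the x_i is of the form
   h_i = x_i w: the map sum c_i x_i |-> sum c_i h_i extends from the ideal of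
   the x_i to R. *)
Lemma injective_solve n (x : seqmod R^o) (h : seqmod E) : injective_module E ->
  (forall c, lincomb n c x = 0 -> lincomb n c h = 0) ->
  exists w : E, forall i, (i < n)%N -> h i = (x i : R) *: w.
Proof.
move=> injE hxh.
pose ix := quo_lift (submodule_ker (lincombl n x)) (fun c (hc : lincombl n x c = 0) => hc).
pose fh := quo_lift (submodule_ker (lincombl n x)) (f := lincombl n h) hxh.
have [g hg] := injE _ _ ix fh (@quo_lift_ker_inj _ _ _ (lincombl n x)).
exists (g (1 : R^o)) => i lt_in; rewrite -linearZ_LR.
have := hg (quo_pi (submodule_ker (lincombl n x)) (seq_in R^o i (1 : R))).
rewrite quo_liftE [fh _]quo_liftE /= !lincomb_inl // !scale1r => <-.
by congr (g _); rewrite [RHS]mulr1.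
Qed.

(* Writing a map from an ideal (x_1, .., x_n) to M (x) E as a tensor u in
   M (x) E^n, flatness of M moves u into M (x) K, where K consists of the tuples
   killed by the finitely many relations between the x_i. *)
Lemma tens_injective : left_noetherian R -> flat_module M -> injective_module E ->
  injective_module (tens M E).
Proof.
move=> noethR flatM injE; apply: Baer => G hG; have [G0 GD GZ Gf] := hG.
have [|s [sJ hs]] := left_ideal_fg (J := fun r : R => exists e, G r e) noethR.
  split=> [|r r' [e h] [e' h']|a r [e h]].
  - by exists 0.
  - by exists (e + e'); apply: GD.
  - by exists (a *: e); apply: GZ.
pose n := size s; pose x : seqmod R^o := fun i => nth 0 s i.
have [v hv] : exists v : seqmod (tens M E), forall i, (i < n)%N -> G (x i) (v i).
  exists (fun i => xget 0 (fun e => G (x i) e)) => i lt_in.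
  by case: (sJ (x i)) => [|e he]; [apply: mem_nth | apply: (@xgetPex _ 0 (G (x i))); exists e].
have Gcomb c : G (lincomb n c x) (lincomb n c v).
  apply: (big_ind2 (fun r e => G r e)) => // i _; last exact/GZ/hv.
have [L [LN hL]] := submodule_fg noethR n (submodule_ker (lincombl n x)).
pose m := size L; pose rel k := nth 0 L k.
(* The tuple of the v_i under the identification of (M (x) E)^n with M (x) E^n. *)
pose u : tens M (seqmod E) := \sum_(i < n) tmap idfun (seq_in E i) (v i).
have urel c : tmap idfun (lincombr E n c) u = lincomb n c v.
  rewrite linear_sum; apply: eq_bigr => i _; rewrite tmapr_comp.
  rewrite (tmapr_scale (a := c i) (f := idfun)) ?tmapr_id //.
  by move=> y /=; rewrite lincomb_inr.
(* Each [rel k] is a relation between the x_i, so [G] relates 0 to the same combination of the v_i,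
   which must vanish. *)
have uker : tmap idfun (seq_tuple (fun k => lincombr E n (rel k)) m) u = 0.
  rewrite (tmapr_sum (f := fun k : 'I_m => seq_in E k \o lincombr E n (rel k))) //.
  apply: big1 => k _; rewrite -tmapr_comp urel (Gf (lincomb n (rel k) v)) ?linear0 //.
  by rewrite -[X in G X](LN (rel k) (mem_nth _ (ltn_ord k))); apply: Gcomb.
have [t [ut tker]] := flat_ker flatM uker.
have [w hw] : exists w : seqmod E -> E,
    forall p, p \in t -> forall i, (i < n)%N -> p.2 i = (x i : R) *: w p.2.
  exists (fun h => xget 0 (fun w => forall i, (i < n)%N -> h i = (x i : R) *: w)).
  move=> p pt; apply: (@xgetPex _ 0 (fun w => forall i, (i < n)%N -> p.2 i = (x i : R) *: w)).
  apply: injective_solve => // c cx.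
  (* The list [L] generates all relations up to coefficients at positions n and beyond, which
     [lincombl n] ignores. *)
  apply: (hL (fun c => lincombl n p.2 c = 0)) => //; first exact: submodule_ker.
    move=> d dL; have := tker p pt => /(congr1 (fun h => h (index d L))).
    by rewrite seq_tupleE index_mem dL /rel nth_index.
  by move=> d d0; apply: big1 => i _; rewrite d0 ?scale0r.
(* Each tuple h occurring in u is (x_i w(h)), so replacing h by w(h) divides all the v_i by the x_i
   at once. *)
exists (\sum_(p <- t) tpure p.1 (w p.2)).
set W := \sum_(p <- t) _.
have vW i : (i < n)%N -> v i = (x i : R) *: W.
  move=> lt_in; transitivity (tmap idfun (seq_ev E i) u).
    rewrite linear_sum (bigD1 (Ordinal lt_in)) //= big1 ?addr0 => [|j /eqP ne_ji].
      by rewrite tmapr_comp tmapr_id // => y; rewrite /= /seq_in_fun eqxx.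
    rewrite tmapr_comp tmapr0 // => y; rewrite /= /seq_in_fun.
    by case: eqP => // e; case: ne_ji; apply: val_inj.
  rewrite ut linear_sum scaler_sumr !big_seq; apply: eq_bigr => p pt.
  rewrite tmapE /= (hw p pt i lt_in).
  exact: (linearZ_LR (Lin ((tpure_bilin M E).1 p.1))).
move=> r e Gre; apply: (linear_graph_eq hG Gre).
apply: (hs (fun r : R => G r (r *: W))); last by exists e.
  split=> [|y z hy hz|a y hy]; first by rewrite scale0r.
    by rewrite scalerDl; apply: GD.
  by rewrite -scalerA; apply: GZ.
move=> y ys; rewrite -(nth_index 0 ys) -[X in G X _]/(x (index y s)).
have lt_yn : (index y s < n)%N by rewrite index_mem.
by rewrite -vW //; apply: hv.
Qed.
End TensorInjective.

(** * Restriction, induction and averaging *)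

Section Restriction.
Variables (R : comPzRingType) (A : algebra R).

(** An alias with the same elements and addition: kernels and images do not change, so acyclicity of
    a restricted complex holds by conversion. *)
Definition res (M : lmodType A) : Type := M.

Section ResModule.
Variable M : lmodType A.
HB.instance Definition _ := GRing.Zmodule.on (res M).

Definition res_scale (r : R) (x : res M) : res M := (alg_unit A r : A) *: (x : M).

Fact res_scaleA r s x : res_scale r (res_scale s x) = res_scale (r * s) x.
Proof. by rewrite /res_scale scalerA rmorphM. Qed.
Fact res_scale1 : left_id 1 res_scale.
Proof. by move=> x; rewrite /res_scale rmorph1 scale1r. Qed.
Fact res_scaleDr : right_distributive res_scale +%R.
Proof. by move=> r x y; apply: scalerDr. Qed.
Fact res_scaleDl x : {morph res_scale^~ x : r s / r + s}.
Proof. by move=> r s; rewrite /res_scale rmorphD scalerDl. Qed.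
HB.instance Definition _ :=
  GRing.Zmodule_isLmodule.Build R (res M)
    res_scaleA res_scale1 res_scaleDr res_scaleDl.

Lemma res_scaleE r (x : res M) : r *: x = ((alg_unit A r : A) *: (x : M) : res M).
Proof. by []. Qed.

Fact act_bilin : bilin (fun (a : alg_mod A) (x : res M) => ((a : A) *: (x : M) : res M)).
Proof.
split=> [a r x y|x r a b].
  by rewrite !res_scaleE scalerDr !scalerA alg_central.
by rewrite alg_scaleE res_scaleE scalerDl scalerA.
Qed.
Definition act : {linear tens (alg_mod A) (res M) -> res M} := tlift act_bilin.

Lemma actE (a : A) (x : M) : act (tpure (a : alg_mod A) (x : res M)) = a *: x.
Proof. exact: tliftE. Qed.
End ResModule.

Fact resL_linear (M N : lmodType A) (f : {linear M -> N}) :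
  linear (fun x : res M => f x : res N).
Proof. by move=> r x y; rewrite !res_scaleE linearP. Qed.
Definition resL (M N : lmodType A) (f : {linear M -> N}) : {linear res M -> res N} :=
  Lin (resL_linear f).

Lemma act_nat (M N : lmodType A) (f : {linear M -> N}) t :
  act N (tA A (resL f) t) = f (act M t).
Proof.
apply: (tens_ext (f := act N \o tA A (resL f)) (g := resL f \o act M)) => a x /=.
by rewrite tAE !actE linearZ_LR.
Qed.

Lemma actA (M : lmodType A) t : act M (tA A (act M) t) = act M (tact A (res M) t).
Proof.
apply: (tens_ext (f := act M \o tA A (act M)) (g := act M \o tact A (res M))) => a u /=.
rewrite tAE tactE.
apply: (tens_ext (f := act M \o Lin ((tpure_bilin (alg_mod A) (res M)).1 a) \o act M)
  (g := act M \o tmap (lmul a) idfun)) => b x /=.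
by rewrite tmapE !actE scalerA.
Qed.

Lemma act_ins (M : lmodType A) (x : res M) : act M (ins A (res M) x) = x.
Proof. by rewrite [LHS]actE scale1r. Qed.

(** * Induction along R -> A and its adjunction with restriction *)

Section Induction.
Variable X : lmodType R.

Definition ind : Type := tens (alg_mod A) X.
HB.instance Definition _ := GRing.Zmodule.on ind.

Definition ind_scale (a : A) (t : ind) : ind := tmap (lmul (a : alg_mod A)) idfun t.

Fact ind_scaleA a b t : ind_scale a (ind_scale b t) = ind_scale (a * b) t.
Proof.
apply: (tens_ext (f := tmap (lmul (a : alg_mod A)) idfun \o tmap (lmul (b : alg_mod A)) idfun)
  (g := tmap (lmul (a * b : alg_mod A)) idfun)) => c x /=.
by rewrite !tmapE /= mulrA.
Qed.
Fact ind_scale1 : left_id 1 ind_scale.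
Proof.
move=> t; apply: (tens_ext (g := (idfun : {linear _ -> _}))) => c x.
by rewrite tmapE /= mul1r.
Qed.
Fact ind_scaleDr : right_distributive ind_scale +%R.
Proof. by move=> a t u; apply: linearD. Qed.
Fact ind_scaleDl t : {morph ind_scale^~ t : a b / a + b}.
Proof.
move=> a b; have := (@tact_bilin R A X).2 t 1 a b.
by rewrite !scale1r.
Qed.
HB.instance Definition _ :=
  GRing.Zmodule_isLmodule.Build A ind
    ind_scaleA ind_scale1 ind_scaleDr ind_scaleDl.

Lemma ind_scaleE (a : A) (t : ind) : a *: t = (tmap (lmul (a : alg_mod A)) idfun t : ind).
Proof. by []. Qed.

Lemma ind_scale_pure (a b : A) (x : X) :
  a *: (tpure (b : alg_mod A) x : ind) = (tpure (a * b : alg_mod A) x : ind).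
Proof. by rewrite ind_scaleE tmapE. Qed.

(* The two R-module structures on A (x) X, one coming from its A-module
   structure, have equal, but not convertible, scalings. *)
Lemma ind_unit_scale (r : R) (t : tens (alg_mod A) X) :
  r *: t = (alg_unit A r : A) *: (t : ind).
Proof.
have lin : linear (fun t : tens (alg_mod A) X => r *: t).
  by move=> k t1 t2; rewrite scalerDr !scalerA mulrC.
apply: (tens_ext (f := Lin lin) (g := tmap (lmul (alg_unit A r : alg_mod A)) idfun)) => a x.
rewrite tmapE /=; exact/esym/(bilinZl (tpure_bilin (alg_mod A) X)).
Qed.

Fact ind_res_linear : linear (fun t : tens (alg_mod A) X => t : res ind).
Proof. by move=> r t u; rewrite ind_unit_scale. Qed.
Definition ind_res : {linear tens (alg_mod A) X -> res ind} := Lin ind_res_linear.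

Fact res_ind_linear : linear (fun t : res ind => t : tens (alg_mod A) X).
Proof. by move=> r t u; rewrite ind_unit_scale. Qed.
Definition res_ind : {linear res ind -> tens (alg_mod A) X} := Lin res_ind_linear.

Lemma act_ind t : act ind (tA A ind_res t) = tact A X t.
Proof.
apply: (tens_ext (f := act ind \o tA A ind_res) (g := ind_res \o tact A X)) => a u /=.
by rewrite tAE actE tactE.
Qed.

Lemma tact_res_ind t : tact A X (tA A res_ind t) = act ind t.
Proof.
apply: (tens_ext (f := tact A X \o tA A res_ind) (g := res_ind \o act ind)) => a u /=.
by rewrite tAE actE tactE.
Qed.
End Induction.

Fact indL_linear (X Y : lmodType R) (f : {linear X -> Y}) :
  linear (fun t : ind X => tA A f t : ind Y).
Proof.
move=> a t u; rewrite linearD; congr (_ + _); rewrite !ind_scaleE.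
apply: (tens_ext (f := tA A f \o tmap (lmul (a : alg_mod A)) idfun)
  (g := tmap (lmul (a : alg_mod A)) idfun \o tA A f)) => b x /=.
by rewrite tmapE !tAE tmapE.
Qed.
Definition indL (X Y : lmodType R) (f : {linear X -> Y}) : {linear ind X -> ind Y} :=
  Lin (indL_linear f).

Section Adjunction.
Variables (X : lmodType R) (M : lmodType A) (f : {linear X -> res M}).

Fact ind_adj_linear : linear (fun t : ind X => act M (tA A f t) : M).
Proof.
move=> a t u; rewrite !linearD; congr (_ + _); rewrite ind_scaleE.
have lin : linear (fun t : tens (alg_mod A) X => a *: (act M (tA A f t) : M) : res M).
  move=> r v w; rewrite !linearP /= scalerDr; congr (_ + _).
  by rewrite !res_scaleE !scalerA alg_central.
apply: (tens_ext (f := act M \o (tA A f \o tmap (lmul (a : alg_mod A)) idfun))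
  (g := Lin lin)) => b x /=.
by rewrite tmapE !tAE !actE /= scalerA.
Qed.
Definition ind_adj : {linear ind X -> M} := Lin ind_adj_linear.

Lemma ind_adj_pure a x : ind_adj (tpure a x) = (a : A) *: (f x : M).
Proof. by rewrite -[LHS]/(act M (tA A f (tpure a x))) tAE actE. Qed.
End Adjunction.

(** Restriction preserves injectives because its left adjoint, induction, preserves injections when
    A is flat. *)
Lemma injective_res (M : lmodType A) :
  flat_module (alg_mod A) -> injective_module M -> injective_module (res M).
Proof.
move=> flatA injM U V i f inji.
have [|g hg] := injM _ _ (indL i) (ind_adj f); first exact: flatA.
exists (resL g \o ind_res V \o ins A V) => u /=.
have := hg (tpure (1 : alg_mod A) u); rewrite ind_adj_pure scale1r => <-.
by congr (g _); apply/esym/tAE.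
Qed.

(** The list stands for e = sum a_i (x) b_i. The first clause is c e = e c in A (x) A, tested
    against bilinear maps, which is the form in which it gets used; the second is mu(e) = 1. *)
Definition separability_element (s : seq (alg_mod A * alg_mod A)) : Prop :=
  (forall (V : lmodType R) (b : alg_mod A -> alg_mod A -> V), bilin b -> forall c,
     \sum_(p <- s) b p.1 (p.2 * c) = \sum_(p <- s) b (c * p.1) p.2) /\
  \sum_(p <- s) p.1 * p.2 = 1.

(** The element is the image of 1 under the bimodule section f: both c f(1) and f(1) c equal
    f(c). *)
Lemma separable_has_element : separable_algebra A -> exists s, separability_element s.
Proof.
move=> [f [fl fr fm]]; exists (repr (f 1)); split=> [V b hb c|]; last first.
  rewrite -[RHS]fm {2}(tens_decomp (f 1)) linear_sum.
  by apply: eq_bigr => p _; rewrite tliftE.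
have := congr1 (tlift hb) (fl c 1); rewrite mulr1 -[in f c](mul1r c) fr.
rewrite {1}(tens_decomp (f 1)) {2}(tens_decomp (f 1)) !linear_sum /=.
under eq_bigr => p _ do rewrite tmapE tliftE.
by under [X in _ = X -> _]eq_bigr => p _ do rewrite tmapE tliftE.
Qed.

(** * Averaging over the separability element *)

Section Averaging.
Variable s : seq (alg_mod A * alg_mod A).
Hypothesis hs : separability_element s.

Section Avg.
Variables (M N : lmodType A) (f : {linear res M -> res N}).

Fact avg_bilin x : bilin (fun a b : alg_mod A =>
  (a : A) *: (f ((b : A) *: (x : M) : res M) : N) : res N).
Proof.
split=> [a r b c|b r a c].
  rewrite alg_scaleE scalerDl -scalerA -res_scaleE.
  by rewrite (linearP f) scalerDr !res_scaleE !scalerA alg_central.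
by rewrite alg_scaleE res_scaleE scalerDl !scalerA.
Qed.

Fact avg_linear : linear (fun x : M =>
  \sum_(p <- s) (p.1 : A) *: (f ((p.2 : A) *: x : res M) : N)).
Proof.
move=> c x y.
have -> : c *: (\sum_(p <- s) (p.1 : A) *: (f ((p.2 : A) *: x : res M) : N)) =
    \sum_(p <- s) (p.1 : A) *: (f ((p.2 : A) *: (c *: x) : res M) : N).
  rewrite scaler_sumr; have := hs.1 _ _ (avg_bilin x) c => /esym e.
  by under eq_bigr do rewrite scalerA; rewrite e; under eq_bigr do rewrite -scalerA.
rewrite -big_split; apply: eq_bigr => p _ /=.
by rewrite -scalerDr -linearD scalerDr.
Qed.

Definition avg : {linear M -> N} := Lin avg_linear.

Lemma avgE x : avg x = \sum_(p <- s) (p.1 : A) *: (f ((p.2 : A) *: x : res M) : N).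
Proof. by []. Qed.

Lemma avg_fixed (g : {linear M -> N}) x : (forall y, f y = g y) -> avg x = g x.
Proof.
move=> fg; rewrite avgE; transitivity ((\sum_(p <- s) (p.1 : A) * p.2) *: g x).
  by rewrite scaler_suml; apply: eq_bigr => p _; rewrite fg linearZ_LR scalerA.
by rewrite [X in X *: _]hs.2 scale1r.
Qed.
End Avg.

(** Averaging an R-linear extension g of f gives again an extension: along the A-linear map i it
    restricts to the average of g o i = f, which is f. *)
Lemma injective_of_res (M : lmodType A) : injective_module (res M) -> injective_module M.
Proof.
move=> injM U V i f inji.
have [//|g hg] := injM _ _ (resL i) (resL f).
exists (avg g) => u; rewrite avgE -[RHS](avg_fixed (f := g \o resL i) (g := f)) //.
by rewrite avgE; apply: eq_bigr => p _; rewrite /= linearZ_LR.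
Qed.

Section Sections.
Variables (M : lmodType A) (X : lmodType R).

Fact act_section_bilin (x : M) : bilin (fun a b : alg_mod A =>
  tpure a ((b : A) *: x : res M)).
Proof.
split=> [a r b c|b r a c]; last exact: (tpure_bilin _ _).2.
rewrite alg_scaleE scalerDl -scalerA -res_scaleE; exact: (tpure_bilin _ _).1.
Qed.

Fact act_section_linear : linear (fun x : M =>
  \sum_(p <- s) tpure p.1 ((p.2 : A) *: x : res M) : ind (res M)).
Proof.
move=> c x y.
have -> : c *: (\sum_(p <- s) tpure p.1 ((p.2 : A) *: x : res M) : ind (res M)) =
    (\sum_(p <- s) tpure p.1 ((p.2 : A) *: (c *: x) : res M) : ind (res M)).
  rewrite scaler_sumr; have := hs.1 _ _ (act_section_bilin x) c => /esym e.
  by under eq_bigr do rewrite ind_scale_pure; rewrite e; under eq_bigr do rewrite -scalerA.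
rewrite -big_split; apply: eq_bigr => p _ /=.
by rewrite scalerDr tpureD.
Qed.
Definition act_section : {linear M -> ind (res M)} := Lin act_section_linear.

Lemma act_sectionE x :
  act_section x = \sum_(p <- s) tpure p.1 ((p.2 : A) *: x : res M).
Proof. by []. Qed.

Lemma act_sectionK x : act M (act_section x) = x.
Proof.
rewrite act_sectionE linear_sum; transitivity ((\sum_(p <- s) (p.1 : A) * p.2) *: x).
  by rewrite scaler_suml; apply: eq_bigr => p _; rewrite actE scalerA.
by rewrite [X in X *: _]hs.2 scale1r.
Qed.

Fact tcomul_linear : linear (fun x : X => \sum_(p <- s) tpure p.1 (tpure p.2 x)).
Proof.
move=> r x y; rewrite scaler_sumr -big_split; apply: eq_bigr => p _ /=.
by rewrite !((tpure_bilin _ _).1).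
Qed.
(** The unit of the monad followed by the section sigma of its multiplication, since sigma sends 1
    to the separability element. *)
Definition tcomul : {linear X -> tens (alg_mod A) (tens (alg_mod A) X)} :=
  Lin tcomul_linear.

Lemma tact_tcomul x : tact A X (tcomul x) = ins A X x.
Proof.
rewrite linear_sum; transitivity (tpure (\sum_(p <- s) p.1 * p.2) x).
  rewrite -[RHS]/(Lin ((tpure_bilin _ _).2 x) _) linear_sum.
  by apply: eq_bigr => p _; rewrite tactE tmapE.
by rewrite hs.2.
Qed.
End Sections.

(** As a composite through the action of N, the average can be compared with a map that respects the
    actions only up to homotopy. *)
Lemma avg_act (M N : lmodType A) (f : {linear res M -> res N}) x :
  avg f x = act N (tA A f (act_section M x)).
Proof.
rewrite avgE act_sectionE !linear_sum; apply: eq_bigr => p _.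
by rewrite tAE actE.
Qed.

Lemma tcomul_nat (X Y : lmodType R) (f : {linear X -> Y}) x :
  tA A (tA A f) (tcomul X x) = tcomul Y (f x).
Proof. by rewrite linear_sum; apply: eq_bigr => p _; rewrite !tAE. Qed.

(** On a (x) x the two sides are sum a_i (x) b_i a (x) x and sum a a_i (x) b_i (x) x, equal because
    the separability element is central. *)
Lemma tcomul_tact (X : lmodType R) t :
  tA A (tact A X) (tcomul (tens (alg_mod A) X) t) = tact A _ (tA A (tcomul X) t).
Proof.
apply: (tens_ext (f := tA A (tact A X) \o tcomul (tens (alg_mod A) X))
  (g := tact A _ \o tA A (tcomul X))) => a x /=.
rewrite tAE tactE !linear_sum /=.
have b_bilin : bilin (fun b c : alg_mod A => tpure b (tpure c x)).
  split=> [b r c d|c r b d]; last exact: (tpure_bilin _ _).2.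
  rewrite (tpure_bilin _ _).2; exact: (tpure_bilin _ _).1.
transitivity (\sum_(p <- s) tpure p.1 (tpure (p.2 * a) x)).
  by apply: eq_bigr => p _; rewrite tAE tactE tmapE.
by rewrite (hs.1 _ _ b_bilin); apply: eq_bigr => p _; rewrite tmapE.
Qed.
End Averaging.
End Restriction.

(** * Equivalences of categories *)

Section Equivalence.
Variables (C D : category) (F : functor C D).
Hypothesis full : forall (X Y : C) (g : mor (F X) (F Y)), exists f, fmap F f = g.
Hypothesis faithful : forall (X Y : C) (f : mor X Y), fmap F f = 0 -> f = 0.

Lemma faithful_inj (X Y : C) : injective (@fmap _ _ F X Y).
Proof.
move=> f g fg; apply/eqP; rewrite -subr_eq0; apply/eqP/faithful.
by rewrite fmapD fmapN fg subrr.
Qed.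

Definition preimage_mor (X Y : C) (g : mor (F X) (F Y)) : mor X Y := sval (cid (full g)).

Lemma preimage_morK (X Y : C) (g : mor (F X) (F Y)) : fmap F (preimage_mor g) = g.
Proof. by rewrite /preimage_mor; case: cid. Qed.

Lemma equivalence_of_essentially_surjective :
  (forall Y : D, exists (X : C) (u : mor (F X) Y), is_iso u) -> is_equivalence F.
Proof.
move=> es.
have data Y : {X : C & {u : mor (F X) Y & {v : mor Y (F X) |
    v ∘ u = idm (F X) /\ u ∘ v = idm Y}}}.
  have [X /cid[u /cid[v uv]]] := cid (es Y).
  by exists X, u, v.
pose gob Y := projT1 (data Y).
pose u Y : mor (F (gob Y)) Y := projT1 (projT2 (data Y)).
pose v Y : mor Y (F (gob Y)) := sval (projT2 (projT2 (data Y))).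
have vu Y : v Y ∘ u Y = idm (F (gob Y)) by rewrite /v; case: (svalP (projT2 (projT2 (data Y)))).
have uv Y : u Y ∘ v Y = idm Y by rewrite /v; case: (svalP (projT2 (projT2 (data Y)))).
clearbody gob u v.
pose gmap Y Y' (f : mor Y Y') := preimage_mor (v Y' ∘ (f ∘ u Y)).
have gmapD Y Y' (f g : mor Y Y') : gmap _ _ (f + g) = gmap _ _ f + gmap _ _ g.
  by apply: faithful_inj; rewrite fmapD !preimage_morK cmpDl cmpDr.
have gmap1 Y : gmap Y Y (idm Y) = idm (gob Y).
  by apply: faithful_inj; rewrite fmap1 preimage_morK cmp1m.
have gmapM X Y Z (g : mor Y Z) (f : mor X Y) :
    gmap _ _ (g ∘ f) = gmap _ _ g ∘ gmap _ _ f.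
  apply: faithful_inj; rewrite fmapM !preimage_morK.
  by rewrite -!cmpA (cmpA (u Y)) uv cmp1m.
exists (Functor gmapD gmap1 gmapM); split.
- exists (fun X => preimage_mor (u (F X))); split=> [X Y f|X] /=.
    apply: faithful_inj; rewrite !fmapM !preimage_morK.
    by rewrite !cmpA uv cmp1m.
  exists (preimage_mor (v (F X))).
  by split; apply: faithful_inj; rewrite fmapM fmap1 !preimage_morK.
- exists u; split=> [X Y f|X] /=; last by exists (v X).
  by rewrite preimage_morK !cmpA uv cmp1m.
Qed.

Definition idempotents_split (E : category) : Prop :=
  forall (X : E) (e : mor X X), e ∘ e = e ->
  exists (W : E) (p : mor X W) (i : mor W X), p ∘ i = idm W /\ i ∘ p = e.

(** The idempotent s r of F X comes from an idempotent of X, as F is full and faithful. The image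
    under F of its splitting and Y both split s r, hence are isomorphic. *)
Lemma equivalence_of_retracts : idempotents_split C ->
  (forall Y : D, exists (X : C) (r : mor (F X) Y) (s : mor Y (F X)), r ∘ s = idm Y) ->
  is_equivalence F.
Proof.
move=> splitC retr; apply: equivalence_of_essentially_surjective => Y.
have [X [r [s rs]]] := retr Y.
have [|W [p [i [pi ip]]]] := splitC X (preimage_mor (s ∘ r)).
  apply: faithful_inj; rewrite fmapM !preimage_morK.
  by rewrite -cmpA (cmpA r) rs cmp1m.
exists W, (r ∘ fmap F i), (fmap F p ∘ s); split.
  rewrite -cmpA (cmpA s) -(preimage_morK (s ∘ r)) -ip fmapM.
  by rewrite !cmpA -fmapM pi fmap1 cmp1m -fmapM pi fmap1.
rewrite -cmpA (cmpA (fmap F i)) -fmapM ip preimage_morK.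
by rewrite -cmpA rs cmpm1 rs.
Qed.
End Equivalence.

Lemma mod_homP (C : tcategory) (M : tmonad C) (X Y : tmodule M) (g : mod_hom X Y) :
  mval g ∘ mact X = mact Y ∘ fmap M (mval g).
Proof. exact: eqP (mvalP g). Qed.

(** * The comparison functor *)

Section RestrictionFunctor.
Variables (R : comPzRingType) (A : algebra R).
Implicit Types X Y : complex A.

Definition rc X : complex R :=
  @Complex R (fun n => res (X n)) (fun n => resL (cdiff X n)) (@cdiffK A X).

Fact rc_map_subproof X Y (f : chain_map X Y) n x :
  resL (f (n + 1)) (cdiff (rc X) n x) = cdiff (rc Y) n (resL (f n) x).
Proof. exact: cmapd. Qed.
Definition rc_map X Y (f : chain_map X Y) : chain_map (rc X) (rc Y) :=
  @ChainMap R (rc X) (rc Y) (fun n => resL (f n)) (rc_map_subproof f).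

Lemma rc_map_homotopic X Y (f g : chain_map X Y) :
  homotopic f g -> homotopic (rc_map f) (rc_map g).
Proof.
move=> /homotopicP[h hh]; apply/homotopicP.
by exists (fun n => resL (h n) : {linear rc X (n + 1) -> rc Y n}) => n x; apply: hh.
Qed.

Definition rk X Y (f : khom X Y) : khom (rc X) (rc Y) := kcls (rc_map (repr f)).

Lemma rkE X Y (f : chain_map X Y) : rk (kcls f) = kcls (rc_map f).
Proof. by apply/kclsP; apply: rc_map_homotopic; apply: krepr_homotopic. Qed.

Definition rfunctor : functor (HoCat A) (HoCat R).
Proof.
refine (@Functor (HoCat A) (HoCat R) rc rk _ _ _).
- move=> X Y; elim/kind => f; elim/kind => g.
  by rewrite /= kclsD !rkE kclsD; apply: kcls_eq.
- by move=> X; rewrite /= rkE; apply: kcls_eq.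
- move=> X Y Z; elim/kind => g; elim/kind => f.
  by rewrite /= kcompE !rkE kcompE; apply: kcls_eq.
Defined.

Fact rsusp_subproof X n (x : rc (cshift X) n) :
  cdiff (rc (cshift X)) n x = cdiff (cshift (rc X)) n x.
Proof. by []. Qed.
Definition rsusp_cm X : chain_map (rc (cshift X)) (cshift (rc X)) :=
  @ChainMap R (rc (cshift X)) (cshift (rc X)) (fun n => idfun) (@rsusp_subproof X).
Definition rsusp_cmV X : chain_map (cshift (rc X)) (rc (cshift X)) :=
  @ChainMap R (cshift (rc X)) (rc (cshift X)) (fun n => idfun)
    (fun n x => esym (rsusp_subproof x)).

Definition rsusp (X : HoCat A) : mor (rfunctor (susp X)) (susp (rfunctor X)) :=
  kcls (rsusp_cm X).

Fact rsusp_nat :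
  natural (F := comp_functor rfunctor susp) (G := comp_functor susp rfunctor) rsusp.
Proof.
move=> X Y; elim/kind => f.
by rewrite /= kshiftE rkE rkE kshiftE !kcompE; apply: kcls_eq.
Qed.

Section RestrictCone.
Variables (X Y : complex A) (u : chain_map X Y).

Fact rcone_linear n : linear (fun p : rc (cone u) n => p : cone (rc_map u) n).
Proof. by []. Qed.
Fact rcone_subproof n (p : rc (cone u) n) :
  Lin (@rcone_linear (n + 1)) (cdiff (rc (cone u)) n p) =
  cdiff (cone (rc_map u)) n (Lin (@rcone_linear n) p).
Proof. by []. Qed.
Definition rcone : chain_map (rc (cone u)) (cone (rc_map u)) :=
  @ChainMap R (rc (cone u)) (cone (rc_map u)) (fun n => Lin (@rcone_linear n))
    rcone_subproof.

Fact rconeV_linear n : linear (fun p : cone (rc_map u) n => p : rc (cone u) n).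
Proof. by []. Qed.
Fact rconeV_subproof n (p : cone (rc_map u) n) :
  Lin (@rconeV_linear (n + 1)) (cdiff (cone (rc_map u)) n p) =
  cdiff (rc (cone u)) n (Lin (@rconeV_linear n) p).
Proof. by []. Qed.
Definition rconeV : chain_map (cone (rc_map u)) (rc (cone u)) :=
  @ChainMap R (cone (rc_map u)) (rc (cone u)) (fun n => Lin (@rconeV_linear n))
    rconeV_subproof.
End RestrictCone.

(** The restriction of a cone is the cone of the restriction, [rcone] being the identity on
    elements. *)
Fact rfunctor_dist (X Y Z : HoCat A) (f : mor X Y) (g : mor Y Z)
    (h : mor Z (susp X)) :
  dist f g h ->
  dist (fmap rfunctor f) (fmap rfunctor g) (rsusp X ∘ fmap rfunctor h).
Proof.
case=> X' [Y' [u [a [b [c [[ia ib ic] [hf hg hh]]]]]]].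
pose T := rfunctor.
pose theta : mor (T (cone u : HoCat A)) (cone (rc_map u) : HoCat R) := kcls (rcone u).
have itheta : is_iso theta.
  exists (kcls (rconeV u)); rewrite /theta /= !kcompE.
  by split; apply: kcls_eq.
have tin : theta ∘ fmap T (kcls (cone_in u) : mor (Y' : HoCat A) (cone u : HoCat A))
    = kcls (cone_in (rc_map u)).
  by rewrite /theta /= rkE kcompE; apply: kcls_eq.
have tout : rsusp X' ∘ fmap T (kcls (cone_out u) : mor (cone u : HoCat A) (susp (X' : HoCat A)))
    = (kcls (cone_out (rc_map u)) :
         mor (cone (rc_map u) : HoCat R) (susp (rc X' : HoCat R))) ∘ theta.
  by rewrite /theta /= rkE !kcompE; apply: kcls_eq.
have tu : kcls (rc_map u) = fmap T (kcls u : mor (X' : HoCat A) (Y' : HoCat A)).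
  by rewrite /= rkE.
exists (rc X'), (rc Y'), (rc_map u), (fmap T a), (fmap T b), (theta ∘ fmap T c).
split; first by split; [| |apply: is_iso_comp => //]; apply: is_iso_fmap.
split.
- by rewrite tu -!fmapM hf.
- by rewrite -cmpA -fmapM hg fmapM cmpA tin.
- have nat_a := rsusp_nat a; rewrite cmpA -nat_a -cmpA.
  by rewrite [fmap (comp_functor _ _) _]/= -fmapM hh fmapM cmpA tout -cmpA.
Qed.

Fact ract_subproof X n t :
  act (X (n + 1)) (cdiff (tc A (rc X)) n t) = cdiff (rc X) n (act (X n) t).
Proof. exact: act_nat. Qed.
Definition ract X : chain_map (tc A (rc X)) (rc X) :=
  @ChainMap R (tc A (rc X)) (rc X) (fun n => act (X n)) (@ract_subproof X).

Definition ic (X : complex R) : complex A :=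
  @Complex A (fun n => ind A (X n)) (fun n => indL A (cdiff X n)) (@tc_subproof R A X).

Fact ic_res_subproof (X : complex R) n t :
  ind_res A (X (n + 1)) (cdiff (tc A X) n t) = cdiff (rc (ic X)) n (ind_res A (X n) t).
Proof. by []. Qed.
Definition ic_res (X : complex R) : chain_map (tc A X) (rc (ic X)) :=
  @ChainMap R (tc A X) (rc (ic X)) (fun n => ind_res A (X n)) (@ic_res_subproof X).

Fact res_ic_subproof (X : complex R) n t :
  res_ind A (X (n + 1)) (cdiff (rc (ic X)) n t) = cdiff (tc A X) n (res_ind A (X n) t).
Proof. by []. Qed.
Definition res_ic (X : complex R) : chain_map (rc (ic X)) (tc A X) :=
  @ChainMap R (rc (ic X)) (tc A X) (fun n => res_ind A (X n)) (@res_ic_subproof X).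

Lemma acyclic_injective_rc (X : HoCat A) : flat_module (alg_mod A) ->
  acyclic_injective X -> acyclic_injective (rfunctor X).
Proof. by move=> flatA [acX injX]; split=> [//|n]; apply/injective_res. Qed.

Section Comparison.
Variable stab : tensor_stable A.
Hypothesis flatA : flat_module (alg_mod A).

Definition rfunctor_ob (X : SingCat A) : tcat (SingCat R) :=
  exist _ (rfunctor (sval X)) (acyclic_injective_rc flatA (svalP X)).

Let T : tmonad (SingCat R) := full_tmonad (@acyclic_injective_susp R) stab.

Fact comparison_actA (X : SingCat A) :
  (kcls (ract (sval X)) : mor (T (rfunctor_ob X)) (rfunctor_ob X)) ∘
    fmap T (kcls (ract (sval X)) : mor (T (rfunctor_ob X)) (rfunctor_ob X)) =
  (kcls (ract (sval X)) : mor (T (rfunctor_ob X)) (rfunctor_ob X)) ∘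
    tmul T (rfunctor_ob X).
Proof. by rewrite /= tkE !kcompE; apply: kcls_eq => n t; apply: actA. Qed.

Fact comparison_act1 (X : SingCat A) :
  (kcls (ract (sval X)) : mor (T (rfunctor_ob X)) (rfunctor_ob X)) ∘
    tunit T (rfunctor_ob X) = idm (rfunctor_ob X).
Proof. by rewrite /= kcompE; apply: kcls_eq => n t; apply: act_ins. Qed.

Definition comparison_ob (X : SingCat A) : ModSing stab :=
  TModule (comparison_actA X) (comparison_act1 X).

(** The intertwining condition read in the homotopy category of R, in the form that [rk_full]
    takes. *)
Lemma comparison_homP (X Y : SingCat A) (g : mod_hom (comparison_ob X) (comparison_ob Y)) :
  kcomp (mval g) (kcls (ract (sval X))) =
  kcomp (kcls (ract (sval Y))) (tk A (mval g)).
Proof. exact: (mod_homP g). Qed.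

Fact comparison_mor_subproof (X Y : SingCat A) (f : mor X Y) :
  mod_mor (X := comparison_ob X) (Y := comparison_ob Y)
    (rk f : mor (rfunctor_ob X) (rfunctor_ob Y)).
Proof.
apply/eqP; elim/kind: f => f; rewrite /= rkE tkE !kcompE.
by apply: kcls_eq => n t; apply/esym/act_nat.
Qed.
Definition comparison_mor (X Y : SingCat A) (f : mor X Y) :
  mor (comparison_ob X) (comparison_ob Y) := ModHom (comparison_mor_subproof f).

Definition comparison_functor : functor (SingCat A) (ModSing stab).
Proof.
refine (@Functor (SingCat A) (ModSing stab) comparison_ob comparison_mor _ _ _).
- by move=> X Y f g; apply: val_inj; apply: (fmapD rfunctor).
- by move=> X; apply: val_inj; apply: (fmap1 rfunctor).
- by move=> X Y Z g f; apply: val_inj; apply: (fmapM rfunctor).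
Defined.

Fact comparison_susp_subproof (X : SingCat A) :
  mod_mor (X := comparison_ob (susp X)) (Y := susp (comparison_ob X))
    (rsusp (sval X) : mor (rfunctor_ob (susp X)) (susp (rfunctor_ob X))).
Proof.
apply/eqP; rewrite /= /mod_susp_act /= /rsusp /tsusp kshiftE tkE !kcompE.
by apply: kcls_eq => n t /=; rewrite tA_id.
Qed.
Fact comparison_suspV_subproof (X : SingCat A) :
  mod_mor (X := susp (comparison_ob X)) (Y := comparison_ob (susp X))
    (kcls (rsusp_cmV (sval X)) : mor (susp (rfunctor_ob X)) (rfunctor_ob (susp X))).
Proof.
apply/eqP; rewrite /= /mod_susp_act /= /rsusp /tsusp kshiftE tkE !kcompE.
by apply: kcls_eq => n t /=; rewrite tA_id.
Qed.
Definition comparison_susp (X : SingCat A) :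
  mor (comparison_functor (susp X)) (susp (comparison_functor X)) :=
  ModHom (comparison_susp_subproof X).

Definition comparison : exact_functor (SingCat A) (ModSing stab).
Proof.
refine (@ExactFunctor (SingCat A) (ModSing stab) comparison_functor comparison_susp _ _ _).
- by move=> X Y f; apply: val_inj; apply: (rsusp_nat f).
- move=> X; exists (ModHom (comparison_suspV_subproof X) :
      mor (susp (comparison_functor X)) (comparison_functor (susp X))).
  by split; apply: val_inj; rewrite /= /rsusp kcompE; apply: kcls_eq.
- by move=> X Y Z f g h; apply: rfunctor_dist.
Defined.
End Comparison.
End RestrictionFunctor.

(** * Splitting of idempotents *)

Lemma injective_prod (B : pzRingType) (E F : lmodType B) :
  injective_module E -> injective_module F ->
  injective_module (E * F)%type.
Proof.
move=> injE injF U V i f inji.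
have lin1 : linear (fun u => (f u).1) by move=> a x y; rewrite linearP.
have lin2 : linear (fun u => (f u).2) by move=> a x y; rewrite linearP.
have [g hg] := injE _ _ i (Lin lin1) inji; have [h hh] := injF _ _ i (Lin lin2) inji.
have lin : linear (fun v => (g v, h v)) by move=> a x y; rewrite !linearP.
by exists (Lin lin) => u; rewrite /= hg hh /=; case: (f u).
Qed.

Lemma injective_seqmod (B : pzRingType) (E : lmodType B) :
  injective_module E -> injective_module (seqmod E).
Proof.
move=> injE U V i f inji.
have g k := cid (injE _ _ i (seq_ev E k \o f) inji).
have lin : linear (fun v => (fun k => sval (g k) v) : seqmod E).
  by move=> a x y; apply/funext => k; rewrite linearP.
exists (Lin lin) => u; apply/funext => k.
exact: (svalP (g k) u).
Qed.

Lemma injective_retract (B : pzRingType) (E F : lmodType B)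
    (r : {linear E -> F}) (s : {linear F -> E}) :
  cancel s r -> injective_module E -> injective_module F.
Proof.
move=> sK injE U V i f inji; have [g hg] := injE _ _ i (s \o f) inji.
by exists (r \o g) => u; rewrite /= hg /= sK.
Qed.

(** * Mapping cones in the homotopy category *)

Section Cones.
Variables (B : pzRingType) (X Y V : complex B) (u : chain_map X Y).

(** The maps x |-> (x, 0) form a null homotopy. *)
Lemma cone_in_comp : (kcls (cone_in u) : mor (Y : Kcat B) (cone u : Kcat B)) ∘
  (kcls u : mor (X : Kcat B) (Y : Kcat B)) = 0.
Proof.
rewrite /= kcompE; apply/kclsP/homotopicP.
have lin n : linear (fun x : X (n + 1) => (x, 0) : cone u n).
  by move=> r x y; congr pair; rewrite /= ?scaler0 ?addr0.
exists (fun n => Lin (lin n)) => n x.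
by rewrite subr0; congr pair; rewrite /= ?addNr // linear0 !addr0.
Qed.

Lemma comp_cone_out : (kcls (cm_shift u) : mor (cshift X : Kcat B) (cshift Y : Kcat B)) ∘
  (kcls (cone_out u) : mor (cone u : Kcat B) (cshift X : Kcat B)) = 0.
Proof.
rewrite /= kcompE; apply/kclsP/homotopicP.
have lin n : linear (fun p : cone u (n + 1) => p.2 : cshift Y n) by [].
exists (fun n => Lin (lin n)) => n p /=.
by rewrite subr0 [RHS]addrC addrK.
Qed.

(** A null homotopy h of f o u supplies the missing component: (x, y) |-> f y + h x is a chain
    map. *)
Lemma cone_extend (f : mor (Y : Kcat B) (V : Kcat B)) :
  f ∘ (kcls u : mor (X : Kcat B) (Y : Kcat B)) = 0 ->
  exists g : mor (cone u : Kcat B) (V : Kcat B), g ∘ kcls (cone_in u) = f.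
Proof.
elim/kind: f => f; rewrite /= kcompE => /kclsP/homotopicP[h hh].
have lin n : linear (fun p : cone u n => f n p.2 + h n p.1).
  by move=> r x y; rewrite /= !linearP scalerDr addrACA.
have ch n p : Lin (lin (n + 1)) (cdiff (cone u) n p) = cdiff V n (Lin (lin n) p).
  have := hh n p.1; rewrite subr0 /= linearN !linearD => ->.
  by rewrite addrAC addrK cmapd addrC.
exists (kcls (@ChainMap _ (cone u) V (fun n => Lin (lin n)) ch)).
by rewrite kcompE; apply: kcls_eq => n x /=; rewrite linear0 addr0.
Qed.

(** If h is a null homotopy of f on Y, then x |-> f (x, 0) - h (u x) is a chain map on the shift of
    X, and (x, y) |-> h y is a homotopy from f to the composite. *)
Lemma cone_factor (f : mor (cone u : Kcat B) (V : Kcat B)) :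
  f ∘ (kcls (cone_in u) : mor (Y : Kcat B) (cone u : Kcat B)) = 0 ->
  exists g : mor (cshift X : Kcat B) (V : Kcat B), f = g ∘ kcls (cone_out u).
Proof.
elim/kind: f => f; rewrite /= kcompE => /kclsP/homotopicP[h hh].
have hin n (y : Y (n + 1)) : f (n + 1) ((0, y) : cone u (n + 1)) =
    cdiff V n (h n y) + h (n + 1) (cdiff Y (n + 1) y).
  by rewrite -hh subr0.
have lin n : linear (fun x : X (n + 1) => f n ((x, 0) : cone u n) - h n (u (n + 1) x)).
  move=> r x y; have -> : ((r *: x + y, 0) : cone u n) = r *: ((x, 0) : cone u n) + (y, 0).
    by congr pair; rewrite /= ?scaler0 ?addr0.
  by rewrite !linearP addrACA -scalerDr.
have ch n (x : X (n + 1)) :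
    Lin (lin (n + 1)) (- cdiff X (n + 1) x) = cdiff V n (Lin (lin n) x).
  rewrite /= [RHS]linearB -(cmapd f) /=.
  have -> : ((- cdiff X (n + 1) x, u (n + 1) x + cdiff Y n 0) : cone u (n + 1)) =
      ((- cdiff X (n + 1) x, 0) : cone u (n + 1)) + (0, u (n + 1) x).
    by congr pair; rewrite /= ?linear0 ?addr0 ?add0r.
  rewrite linearD hin -cmapd !linearN opprK.
  by rewrite [in RHS](addrC (cdiff V n _)) addrA addrK.
have lin2 n : linear (fun p : cone u (n + 1) => h n p.2).
  by move=> r x y; rewrite /= linearP.
exists (kcls (@ChainMap _ (cshift X) V (fun n => Lin (lin n)) ch)).
rewrite kcompE; apply/kclsP/homotopicP; exists (fun n => Lin (lin2 n)) => n [x y] /=.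
have -> : ((x, y) : cone u (n + 1)) = ((x, 0) : cone u (n + 1)) + (0, y).
  by congr pair; rewrite /= ?addr0 ?add0r.
rewrite [f _ (_ + _)]linearD hin [h _ (_ + _)]linearD opprB.
set b := cdiff V n _; set c := h _ (cdiff _ _ _); set k := h _ (u _ _).
by rewrite [k - _]addrC addrACA subrr add0r -[LHS]addrA [c + k]addrC.
Qed.

Lemma acyclic_cone : acyclic X -> acyclic Y -> acyclic (cone u).
Proof.
move=> acX acY n [x y] /= [/eqP]; rewrite oppr_eq0 => /eqP dx.
have [x' dx'] := acX _ _ dx; rewrite -dx' cmapd -linearD => /acY[y' dy'].
exists (- x', y'); congr pair; rewrite /= linearN ?opprK //.
by rewrite dy' addrA addNr add0r.
Qed.
End Cones.

(** * Countable powers of a complex *)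

Section Products.
Variables (B : pzRingType) (Z : complex B).

Fact pc_diff_linear n :
  linear (fun x : seqmod (Z n) => (fun i => cdiff Z n (x i)) : seqmod (Z (n + 1))).
Proof. by move=> r x y; apply/funext => i; rewrite linearP. Qed.
Fact pc_diffK n (x : seqmod (Z n)) :
  Lin (@pc_diff_linear (n + 1)) (Lin (@pc_diff_linear n) x) = 0.
Proof. by apply/funext => i; apply: cdiffK. Qed.
Definition pc : complex B :=
  @Complex B (fun n => seqmod (Z n)) (fun n => Lin (@pc_diff_linear n)) pc_diffK.

Fact pc_ev_subproof i n (x : pc n) :
  seq_ev (Z (n + 1)) i (cdiff pc n x) = cdiff Z n (seq_ev (Z n) i x).
Proof. by []. Qed.
Definition pc_ev i : mor (pc : Kcat B) (Z : Kcat B) :=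
  kcls (@ChainMap B pc Z (fun n => seq_ev (Z n) i) (@pc_ev_subproof i)).

Lemma pc_pair (W : Kcat B) (f : nat -> mor W (Z : Kcat B)) :
  exists g : mor W (pc : Kcat B), forall i, pc_ev i ∘ g = f i.
Proof.
have lin n : linear (fun x : (W : complex B) n => (fun i => repr (f i) n x) : pc n).
  by move=> r x y; apply/funext => i; rewrite linearP.
have ch n x : Lin (lin (n + 1)) (cdiff W n x) = cdiff pc n (Lin (lin n) x).
  by apply/funext => i; apply: cmapd.
exists (kcls (@ChainMap B W pc (fun n => Lin (lin n)) ch)) => i.
by rewrite /pc_ev /= kcompE -[RHS]kreprK; apply: kcls_eq.
Qed.

(** Homotopies chosen separately for each coordinate assemble into one, so the degreewise product is
    also the product in the homotopy category. *)
Lemma pc_ext (W : Kcat B) (f g : mor W (pc : Kcat B)) :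
  (forall i, pc_ev i ∘ f = pc_ev i ∘ g) -> f = g.
Proof.
elim/kind: f => f; elim/kind: g => g fg.
have H i : exists h, homotopy (cm_comp (@ChainMap B pc Z (fun n => seq_ev (Z n) i)
    (@pc_ev_subproof i)) f) (cm_comp (@ChainMap B pc Z (fun n => seq_ev (Z n) i)
    (@pc_ev_subproof i)) g) h.
  by apply/homotopicP/kclsP; rewrite -!kcompE; apply: fg.
pose h i := sval (cid (H i)); have hh i := svalP (cid (H i)).
have lin n : linear (fun x : (W : complex B) (n + 1) => (fun i => h i n x) : pc n).
  by move=> r x y; apply/funext => i; rewrite linearP.
apply/kclsP/homotopicP; exists (fun n => Lin (lin n)) => n x.
by apply/funext => i; apply: (hh i n x).
Qed.

Lemma acyclic_pc : acyclic Z -> acyclic pc.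
Proof.
move=> acZ n x dx.
have y i : {y | cdiff Z n y = x i}.
  by apply: cid; apply: acZ; apply: (congr1 (fun z : seqmod _ => z i) dx).
by exists (fun i => sval (y i)); apply/funext => i; apply: (svalP (y i)).
Qed.
End Products.

Section IdempotentSplitting.
Variables (B : pzRingType) (Z : complex B) (e : mor (Z : Kcat B) (Z : Kcat B)).
Hypothesis ee : e ∘ e = e.

(* If e were split with image Z', the map t would be the right shift on the
   factor Z'^nat of Z^nat and the identity on the complementary factor, with
   cokernel Z'. Hence the cone of t is Z'. *)
Lemma idempotent_split_cone : exists (t : chain_map (pc Z) (pc Z))
  (p : mor (Z : Kcat B) (cone t : Kcat B)) (i : mor (cone t : Kcat B) (Z : Kcat B)),
  p ∘ i = idm (cone t : Kcat B) /\ i ∘ p = e.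
Proof.
have [f [ef fe ff fDe]] : exists f : mor (Z : Kcat B) (Z : Kcat B),
    [/\ e ∘ f = 0, f ∘ e = 0, f ∘ f = f
      & forall (W : Kcat B) (x : mor W (Z : Kcat B)), f ∘ x + e ∘ x = x].
  exists (idm (Z : Kcat B) - e); have ef : e ∘ (idm (Z : Kcat B) - e) = 0.
    by rewrite cmpDr cmpmN cmpm1 ee subrr.
  split=> [//|||W x]; last by rewrite -cmpDl subrK cmp1m.
    by rewrite cmpDl cmpNm cmp1m ee subrr.
  by rewrite {1}cmpDl cmpNm cmp1m ef subr0.
(* With f = 1 - e, the map [t0] keeps the f-part and shifts the e-part to the right. Then [l] shifts
   the e-part back, and [j] inserts the image of e in the coordinate 0 that the shift leaves
   free. *)
have [t0 ht] := pc_pair (fun i => if i is i'.+1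
  then e ∘ pc_ev Z i' + f ∘ pc_ev Z i'.+1 else f ∘ pc_ev Z 0).
have [l hl] := pc_pair (fun i => f ∘ pc_ev Z i + e ∘ pc_ev Z i.+1).
have [j hj] := pc_pair (fun i => if i is i'.+1 then 0 else e).
have ht0 : pc_ev Z 0 ∘ t0 = f ∘ pc_ev Z 0 := ht 0.
have htS i : pc_ev Z i.+1 ∘ t0 = e ∘ pc_ev Z i + f ∘ pc_ev Z i.+1 := ht i.+1.
have hj0 : pc_ev Z 0 ∘ j = e := hj 0.
have hjS i : pc_ev Z i.+1 ∘ j = 0 := hj i.+1.
pose q := e ∘ pc_ev Z 0.
have qj : q ∘ j = e by rewrite /q -cmpA hj0 ee.
have qt : q ∘ t0 = 0 by rewrite /q -cmpA ht0 cmpA ef cmp0m.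
have lt1 : l ∘ t0 = idm _.
  apply: pc_ext => i; rewrite cmpA hl cmpm1 cmpDl -!cmpA htS.
  case: i => [|i]; rewrite ?ht0 ?htS !cmpDr !cmpA ?fe ee ef ff !cmp0m.
    by rewrite [X in _ + X]addr0 fDe.
  by rewrite [X in _ + X]addr0 [X in X + _]add0r fDe.
have tl1 : t0 ∘ l + j ∘ q = idm _.
  apply: pc_ext => i; rewrite cmpDr !cmpA cmpm1.
  case: i => [|i].
    by rewrite ht0 hj0 -cmpA hl cmpDr /q !cmpA ff fe ee cmp0m [X in X + _]addr0 fDe.
  rewrite htS hjS !cmp0m [LHS]addr0 cmpDl -!cmpA !hl !cmpDr !cmpA ef ee ff fe !cmp0m.
  by rewrite [X in _ + X]addr0 [X in X + _]add0r [LHS]addrC fDe.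
have [t tE] : exists t, kcls t = t0 by exists (repr t0); apply: kreprK.
have [|i hi] := @cone_extend _ _ _ (Z : complex B) t q; first by rewrite tE.
have in_t0 : (kcls (cone_in t) : mor (pc Z : Kcat B) (cone t : Kcat B)) ∘ t0 = 0.
  by rewrite -tE cone_in_comp.
pose p := (kcls (cone_in t) : mor (pc Z : Kcat B) (cone t : Kcat B)) ∘ j.
exists t, p, i; split; last by rewrite /p cmpA hi.
(* The difference p i - 1 vanishes on [cone_in], hence factors through [cone_out]; and [cone_out] is
   zero, being killed by the shift of [t0], which has the left inverse [l]. *)
have [|g hg] := @cone_factor _ _ _ (cone t) t (p ∘ i - idm _).
  rewrite cmpDl cmpNm cmp1m -cmpA hi /p -cmpA.
  have -> : j ∘ q = idm _ - t0 ∘ l by rewrite -tl1 [RHS]addrC [RHS]addKr.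
  by rewrite cmpDr cmpmN cmpA in_t0 cmp0m cmpm1 subr0 subrr.
apply/eqP; rewrite -subr_eq0 hg; apply/eqP.
pose out : mor (cone t : Kcat B) (cshift (pc Z) : Kcat B) := kcls (cone_out t).
suff out0 : out = 0 by rewrite [kcls _]out0 cmpm0.
have shift_t : fmap (Ksusp B) t0 = kcls (cm_shift t) by rewrite -tE; apply: kshiftE.
have out_t : fmap (Ksusp B) t0 ∘ out = 0 by rewrite shift_t; apply: comp_cone_out.
have shift_lt : fmap (Ksusp B) l ∘ fmap (Ksusp B) t0 = idm _ by rewrite -fmapM lt1 fmap1.
by rewrite -(cmp1m out) -[idm _]shift_lt -cmpA out_t cmpm0.
Qed.
End IdempotentSplitting.

Lemma SingCat_idempotents_split (B : pzRingType) : idempotents_split (SingCat B).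
Proof.
move=> [Z [acZ injZ]] e ee.
have [t [p [i pi]]] := idempotent_split_cone ee.
have aiW : acyclic_injective (cone t : HoCat B).
  split=> [|n]; first by apply: acyclic_cone; apply: acyclic_pc.
  by apply: injective_prod; apply: injective_seqmod.
by exists (exist _ (cone t : HoCat B) aiW), p, i.
Qed.

(** * The equivalence *)

Section MainTheorem.
Variables (R : comPzRingType) (A : algebra R).
Hypotheses (noethR : left_noetherian R) (flatA : flat_module (alg_mod A)).

(** By flatness a cycle of A (x) X is a sum of tensors a (x) z with z a cycle, and each z is a
    boundary. *)
Lemma acyclic_tc (X : complex R) : acyclic X -> acyclic (tc A X).
Proof.
move=> acX n t dt; have [s [-> hs]] := flat_ker flatA dt.
rewrite big_seq; elim/big_ind: _ => [|t1 t2 [y1 <-] [y2 <-]|p ps].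
- by exists 0; rewrite linear0.
- by exists (y1 + y2); rewrite linearD.
- by have [y <-] := acX _ _ (hs p ps); exists (tpure p.1 y); apply: tAE.
Qed.

Lemma flat_tensor_stable : tensor_stable A.
Proof.
move=> X [acX injX]; split=> [|n]; first exact: acyclic_tc.
exact: tens_injective.
Qed.

Variables (s : seq (alg_mod A * alg_mod A)) (hs : separability_element s).

Lemma acyclic_injective_ic (X : HoCat R) :
  acyclic_injective X -> acyclic_injective (ic A X : HoCat A).
Proof.
move=> aiX; have [acX injX] := flat_tensor_stable aiX; split=> [|n]; first exact: acX.
apply: (injective_of_res hs).
by apply: (injective_retract (r := ind_res A _) (s := res_ind A _)) => //; apply: injX.
Qed.

Fact section_cm_subproof (X : complex A) n x :
  act_section hs (X (n + 1)) (cdiff X n x) =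
  cdiff (ic A (rc X)) n (act_section hs (X n) x).
Proof.
(* The formula sum a_i (x) b_i x commutes with every A-linear map, in particular with the
   differential. *)
rewrite act_sectionE [RHS](linear_sum (tA A _)); apply: eq_bigr => p _.
by rewrite tAE /= linearZ_LR.
Qed.
Definition section_cm (X : complex A) : chain_map X (ic A (rc X)) :=
  @ChainMap A X (ic A (rc X)) (fun n => act_section hs (X n)) (@section_cm_subproof X).

Fact avg_cm_subproof (X Y : complex A) (f : chain_map (rc X) (rc Y)) n x :
  avg hs (f (n + 1)) (cdiff X n x) = cdiff Y n (avg hs (f n) x).
Proof.
rewrite !avgE linear_sum; apply: eq_bigr => p _.
rewrite linearZ_LR -[in LHS]linearZ_LR.
congr (_ *: _); exact: (cmapd f).
Qed.
Definition avg_cm (X Y : complex A) (f : chain_map (rc X) (rc Y)) : chain_map X Y :=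
  @ChainMap A X Y (fun n => avg hs (f n)) (avg_cm_subproof f).

Let F := comparison flat_tensor_stable flatA.

Lemma comparison_faithful (X Y : SingCat A) (f : mor X Y) : fmap F f = 0 -> f = 0.
Proof.
move=> /(congr1 (@mval _ _ _ _)); elim/kind: f => f; rewrite /= rkE.
move=> /kclsP/homotopicP[h hh]; apply/kclsP/homotopicP.
exists (fun n => avg hs (h n)) => n x.
(* The chain map is A-linear, hence equal to its own average, so the averaged homotopy contracts
   it. *)
rewrite -[LHS](avg_fixed hs (f := resL (f (n + 1) \- cm0 _ _ (n + 1)))
  (g := f (n + 1) \- cm0 _ _ (n + 1))) //.
rewrite !avgE linear_sum -big_split; apply: eq_bigr => p _ /=.
rewrite (linearZ_LR (cdiff (sval Y) n)) -(linearZ_LR (cdiff (sval X) (n + 1))) -scalerDr.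
by congr (_ *: _); apply: (hh n).
Qed.

(** The average of g is act o (A (x) g) o section. The hypothesis makes this homotopic to g o act o
    section, and act o section is the identity. *)
Lemma rk_full (X Y : complex A) (g : khom (rc X) (rc Y)) :
  kcomp g (kcls (ract X)) = kcomp (kcls (ract Y)) (tk A g) -> exists f, rk f = g.
Proof.
elim/kind: g => g; rewrite tkE !kcompE => /esym/kclsP hg.
exists (kcls (avg_cm g)); rewrite rkE.
pose sec : chain_map (rc X) (tc A (rc X)) :=
  cm_comp (res_ic A (rc X)) (rc_map (section_cm X)).
transitivity (kcls (cm_comp (cm_comp (ract Y) (tc_map A g)) sec)).
  by apply: kcls_eq => n x; apply: (avg_act hs).
transitivity (kcls (cm_comp (cm_comp g (ract X)) sec)).
  by apply/kclsP/cm_comp_homotopic; [exact: hg | exact: homotopic_refl].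
by apply: kcls_eq => n x; congr (g n _); apply: (act_sectionK hs).
Qed.

Lemma comparison_full (X Y : SingCat A) (g : mor (F X) (F Y)) : exists f, fmap F f = g.
Proof. by have [f hf] := rk_full (comparison_homP g); exists f; apply: val_inj. Qed.

Fact tcomul_cm_subproof (X : complex R) n x :
  tcomul s (X (n + 1)) (cdiff X n x) = cdiff (tc A (tc A X)) n (tcomul s (X n) x).
Proof. exact/esym/tcomul_nat. Qed.
Definition tcomul_cm (X : complex R) : chain_map X (tc A (tc A X)) :=
  @ChainMap R X (tc A (tc A X)) (fun n => tcomul s (X n)) (@tcomul_cm_subproof X).

(* The section of the action X <- A (x) X is x |-> sum a_i (x) b_i x, where
   sum a_i (x) b_i is the separability element. *)
Lemma comparison_retract (Y : ModSing flat_tensor_stable) :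
  exists (X : SingCat A) (r : mor (F X) Y) (i : mor Y (F X)), r ∘ i = idm Y.
Proof.
case: Y => -[Y aiY] a aA a1; pose T := tensor_monad A.
(* The computation is moved to the homotopy category of R, of which the singularity category is a
   full subcategory, so that the maps of the monad are classes of explicit chain maps. *)
pose X : SingCat A := exist _ (ic A Y : HoCat A) (acyclic_injective_ic aiY).
pose YH : HoCat R := Y; pose XH : HoCat R := rc (ic A Y).
pose al : mor (T YH) YH := a.
have alA : al ∘ fmap T al = al ∘ tmul T YH by exact: aA.
have al1 : al ∘ tunit T YH = idm YH by exact: a1.
pose rho : mor XH (T YH) := kcls (res_ic A Y).
pose iota : mor (T YH) XH := kcls (ic_res A Y).
pose actX : mor (T XH) XH := kcls (ract (ic A Y)).
pose tau (W : HoCat R) : mor W (T (T W)) := kcls (tcomul_cm W).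
have rho_act : rho ∘ actX = tmul T YH ∘ fmap T rho.
  by rewrite /= tkE !kcompE; apply: kcls_eq => n t; rewrite /= tact_res_ind.
have iota_mul : iota ∘ tmul T YH = actX ∘ fmap T iota.
  by rewrite /= tkE !kcompE; apply: kcls_eq => n t; rewrite /= act_ind.
have rhoK : rho ∘ iota = idm _ by rewrite /= kcompE; apply: kcls_eq.
have tau_nat (V W : HoCat R) (f : mor V W) : fmap T (fmap T f) ∘ tau V = tau W ∘ f.
  elim/kind: f => f; rewrite /= !tkE !kcompE; apply: kcls_eq => n x.
  exact: tcomul_nat.
have tau_mul W : fmap T (tmul T W) ∘ tau (T W) = tmul T (T W) ∘ fmap T (tau W).
  by rewrite /= !tkE !kcompE; apply: kcls_eq => n x; apply: (tcomul_tact hs).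
have tauK W : tmul T W ∘ tau W = tunit T W.
  by rewrite /= kcompE; apply: kcls_eq => n x; apply: (tact_tcomul hs).
have hr : (al ∘ rho) ∘ actX = al ∘ fmap T (al ∘ rho).
  by rewrite fmapM -cmpA rho_act !cmpA alA.
(* Uses naturality of [tau], associativity of the action, centrality in the form [tau_mul], and
   naturality of the multiplication. *)
have hi : (iota ∘ (fmap T al ∘ tau YH)) ∘ al = actX ∘ fmap T (iota ∘ (fmap T al ∘ tau YH)).
  rewrite -!cmpA -tau_nat (cmpA (fmap T al)) -fmapM alA fmapM -cmpA tau_mul.
  rewrite (cmpA (fmap T al)) -(tmul_nat T al) -cmpA (cmpA iota) iota_mul.
  by rewrite -cmpA -!fmapM.
(* After [rho] and [iota] cancel, associativity turns [al] o T [al] o [tau] into [al] o mu o [tau],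
   which is [al] o unit, the identity. *)
have ri : (al ∘ rho) ∘ (iota ∘ (fmap T al ∘ tau YH)) = idm YH.
  by rewrite -cmpA (cmpA rho) rhoK cmp1m cmpA alA -cmpA tauK.
exists X.
exists (@ModHom _ _ (F X) (TModule aA a1) (al ∘ rho) (introT eqP hr)).
exists (@ModHom _ _ (TModule aA a1) (F X) (iota ∘ (fmap T al ∘ tau YH)) (introT eqP hi)).
apply: val_inj; exact: ri.
Qed.
End MainTheorem.

Theorem theorem5p5 (R : comPzRingType) (A : algebra R) :
  noetherian_ring R -> noetherian_ring A ->
  separable_algebra A -> flat_module (alg_mod A) ->
  exists (stab : tensor_stable A)
         (E : exact_functor (SingCat A) (ModSing stab)),
    is_equivalence E.
Proof.
move=> [noethR _] _ sepA flatA; have [s hs] := separable_has_element sepA.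
exists (flat_tensor_stable noethR flatA).
exists (comparison (flat_tensor_stable noethR flatA) flatA).
apply: equivalence_of_retracts.
- exact: (comparison_full hs).
- exact: (comparison_faithful hs).
- exact: SingCat_idempotents_split.
- exact: (comparison_retract hs).
Qed.
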